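(* There exists an algorithm which, given a labeled colored graph $G$ with $l$ labels and neighborhood diversity at most $w$, and an MSO formula $\phi$ with at most $q_S$ set variables and at most $q_V$ vertex variables, decides whether $G\models\phi$ in time $2^{O\left(2^{q_S}(w+l)q_S^2q_V\log q_V\right)}\cdot|\phi|$.
   Context: A labeled colored graph is a finite simple undirected graph $G=(V,E)$ with a finite set of labels, each assigned to a vertex, and a finite collection of (not necessarily disjoint) subsets of $V$ called color classes. MSO formulas (MSO$_1$) are built from vertex variables, vertex-set variables, labels (as constants), color class symbols, atoms $E(s,t)$, $s=t$, $s\in C$ (with $C$ a color class or set variable), Boolean connectives, and quantifiers over vertices and vertex sets, with standard semantics; $|\phi|$ is its length. Two vertices $v,v'$ have the same type iff they lie in the same color classes and $N(v)\setminus\{v'\}=N(v')\setminus\{v\}$. $G$ has neighborhood diversity at most $w$ if $V$ can be partitioned into at most $w$ sets each consisting of vertices of pairwise the same type. Convention of the paper: such a partition into at most $w$ sets is assumed given as part of the input. *)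

(* Defs.v *)
From mathcomp Require Import all_boot.

Set Implicit Arguments.
Unset Strict Implicit.
Unset Printing Implicit Defensive.

(* Simple graphs on the vertex set {0, ..., n-1} with l labels, each naming a
   vertex, and c colour classes. *)
Record lcgraph (n l c : nat) := LCGraph {
  adj : rel 'I_n;
  adj_sym : symmetric adj;
  adj_irr : irreflexive adj;
  lab : 'I_l -> 'I_n;
  col : 'I_c -> {set 'I_n}
}.

Definition nbr n l c (G : lcgraph n l c) (v : 'I_n) : {set 'I_n} :=
  [set u | adj G v u].

Definition same_type n l c (G : lcgraph n l c) (v v' : 'I_n) : Prop :=
  (forall i, (v \in col G i) = (v' \in col G i)) /\
  nbr G v :\ v' = nbr G v' :\ v.

(* A partition of the vertices is given by listing its blocks: [perm_eq] says
   that every vertex occurs exactly once in exactly one block. The graph has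
   neighborhood diversity at most w iff it has such a P with size P <= w. *)
Definition nd_partition n l c (G : lcgraph n l c) (P : seq (seq 'I_n)) : Prop :=
  perm_eq (flatten P) (enum 'I_n) /\
  forall B, B \in P -> {in B &, forall v v', same_type G v v'}.

Inductive term (l : nat) := Var of nat | Lab of 'I_l.

Inductive connective := And | Or | Imp | Iff.

(* Vertex variables and set variables are two separate families of names, each
   indexed by nat. *)
Inductive mso (l c : nat) :=
| Edge of term l & term l
| Equal of term l & term l
| InCol of term l & 'I_c
| InSet of term l & nat
| Not of mso l c
| Bin of connective & mso l c & mso l c
| ExV of nat & mso l c
| AllV of nat & mso l c
| ExS of nat & mso l c
| AllS of nat & mso l c.

(* Length |phi|: every relation symbol, connective, quantifier, variable, label
   and colour class counts as one symbol. *)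
Fixpoint mso_len l c (phi : mso l c) : nat :=
  match phi with
  | Edge _ _ | Equal _ _ | InCol _ _ | InSet _ _ => 3
  | Not f => (mso_len f).+1
  | Bin _ f g => (mso_len f + mso_len g).+1
  | ExV _ f | AllV _ f | ExS _ f | AllS _ f => (mso_len f).+2
  end.

(* Numbers of set variables and of vertex variables. Each quantifier is counted
   as binding a variable of its own, i.e. variables are counted after renaming
   bound variables apart; a name that is quantified again counts again. *)
Fixpoint num_svars l c (phi : mso l c) : nat :=
  match phi with
  | Edge _ _ | Equal _ _ | InCol _ _ | InSet _ _ => 0
  | Not f | ExV _ f | AllV _ f => num_svars f
  | Bin _ f g => num_svars f + num_svars g
  | ExS _ f | AllS _ f => (num_svars f).+1
  end.

Fixpoint num_vvars l c (phi : mso l c) : nat :=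
  match phi with
  | Edge _ _ | Equal _ _ | InCol _ _ | InSet _ _ => 0
  | Not f | ExS _ f | AllS _ f => num_vvars f
  | Bin _ f g => num_vvars f + num_vvars g
  | ExV _ f | AllV _ f => (num_vvars f).+1
  end.

Definition term_scoped l (vs : seq nat) (t : term l) : bool :=
  if t is Var x then x \in vs else true.

(* All free vertex (set) variables of the formula belong to vs (to ss). *)
Fixpoint scoped l c (vs ss : seq nat) (phi : mso l c) : bool :=
  match phi with
  | Edge s t | Equal s t => term_scoped vs s && term_scoped vs t
  | InCol t _ => term_scoped vs t
  | InSet t X => term_scoped vs t && (X \in ss)
  | Not f => scoped vs ss f
  | Bin _ f g => scoped vs ss f && scoped vs ss g
  | ExV x f | AllV x f => scoped (x :: vs) ss f
  | ExS X f | AllS X f => scoped vs (X :: ss) f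
  end.

Definition sentence l c (phi : mso l c) : bool := scoped [::] [::] phi.

Definition upd (T : Type) (f : nat -> T) (x : nat) (v : T) : nat -> T :=
  fun y => if y == x then v else f y.

Definition conn_sem (o : connective) (a b : bool) : bool :=
  match o with
  | And => a && b
  | Or => a || b
  | Imp => a ==> b
  | Iff => a == b
  end.

(* Vertex assignments are partial so that the empty graph needs no special
   treatment; unassigned variables never occur when evaluating a sentence. *)
Definition term_val n l c (G : lcgraph n l c) (ev : nat -> option 'I_n)
    (t : term l) : option 'I_n :=
  match t with Var x => ev x | Lab i => Some (lab G i) end.

Fixpoint sat n l c (G : lcgraph n l c) (ev : nat -> option 'I_n)
    (es : nat -> {set 'I_n}) (phi : mso l c) : bool :=
  match phi with
  | Edge s t =>
      if (term_val G ev s, term_val G ev t) is (Some u, Some v) then adj G u v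
      else false
  | Equal s t =>
      if (term_val G ev s, term_val G ev t) is (Some u, Some v) then u == v
      else false
  | InCol t i => if term_val G ev t is Some u then u \in col G i else false
  | InSet t X => if term_val G ev t is Some u then u \in es X else false
  | Not f => ~~ sat G ev es f
  | Bin o f g => conn_sem o (sat G ev es f) (sat G ev es g)
  | ExV x f => [exists v : 'I_n, sat G (upd ev x (Some v)) es f]
  | AllV x f => [forall v : 'I_n, sat G (upd ev x (Some v)) es f]
  | ExS X f => [exists A : {set 'I_n}, sat G ev (upd es X A) f]
  | AllS X f => [forall A : {set 'I_n}, sat G ev (upd es X A) f]
  end.

Definition models n l c (G : lcgraph n l c) (phi : mso l c) : bool :=
  sat G (fun _ => None) (fun _ => set0) phi.

(* Algorithms are structured programs for a unit-cost RAM with addition and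
   truncated subtraction only: multiplication at unit cost would make the
   model unreasonably powerful. A program uses finitely many registers and
   finitely many arrays of natural numbers. *)
Inductive expr :=
| Const of nat
| Reg of nat
| Get of nat & expr            (* Get a e : entry e of array a *)
| Add of expr & expr
| Sub of expr & expr.

Inductive cmd :=
| Skip
| Assign of nat & expr         (* Assign x e : register x := e *)
| Put of nat & expr & expr     (* Put a e1 e2 : entry e1 of array a := e2 *)
| Seq of cmd & cmd
| If of expr & cmd & cmd       (* a condition holds iff it is nonzero *)
| While of expr & cmd.

Record store := Store { reg : nat -> nat; arr : nat -> nat -> nat }.

Fixpoint eval (s : store) (e : expr) : nat :=
  match e with
  | Const k => k
  | Reg x => reg s x
  | Get a e1 => arr s a (eval s e1)
  | Add e1 e2 => eval s e1 + eval s e2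
  | Sub e1 e2 => eval s e1 - eval s e2
  end.

Fixpoint cost (e : expr) : nat :=
  match e with
  | Const _ | Reg _ => 1
  | Get _ e1 => (cost e1).+1
  | Add e1 e2 | Sub e1 e2 => (cost e1 + cost e2).+1
  end.

(* [exec p s t s']: started in s, the program p halts in s' after t steps. *)
Inductive exec : cmd -> store -> nat -> store -> Prop :=
| ExecSkip s : exec Skip s 1 s
| ExecAssign x e s :
    exec (Assign x e) s (cost e).+1 (Store (upd (reg s) x (eval s e)) (arr s))
| ExecPut a e1 e2 s :
    exec (Put a e1 e2) s (cost e1 + cost e2).+1
      (Store (reg s)
         (upd (arr s) a (upd (arr s a) (eval s e1) (eval s e2))))
| ExecSeq p1 p2 s s1 s2 t1 t2 :
    exec p1 s t1 s1 -> exec p2 s1 t2 s2 -> exec (Seq p1 p2) s (t1 + t2) s2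
| ExecIfTrue e p1 p2 s s1 t :
    eval s e != 0 -> exec p1 s t s1 -> exec (If e p1 p2) s (cost e + t).+1 s1
| ExecIfFalse e p1 p2 s s1 t :
    eval s e = 0 -> exec p2 s t s1 -> exec (If e p1 p2) s (cost e + t).+1 s1
| ExecWhileTrue e p s s1 s2 t1 t2 :
    eval s e != 0 -> exec p s t1 s1 -> exec (While e p) s1 t2 s2 ->
    exec (While e p) s (cost e + t1 + t2).+1 s2
| ExecWhileFalse e p s :
    eval s e = 0 -> exec (While e p) s (cost e).+1 s.

Definition enc_term l (t : term l) : seq nat :=
  match t with Var x => [:: 0; x] | Lab i => [:: 1; val i] end.

Definition enc_conn (o : connective) : nat :=
  match o with And => 5 | Or => 6 | Imp => 7 | Iff => 8 end.

(* Prefix notation, with opcodes 0 to 12. *)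
Fixpoint enc_mso l c (phi : mso l c) : seq nat :=
  match phi with
  | Edge s t => 0 :: enc_term s ++ enc_term t
  | Equal s t => 1 :: enc_term s ++ enc_term t
  | InCol t i => 2 :: rcons (enc_term t) (val i)
  | InSet t X => 3 :: rcons (enc_term t) X
  | Not f => 4 :: enc_mso f
  | Bin o f g => enc_conn o :: enc_mso f ++ enc_mso g
  | ExV x f => 9 :: x :: enc_mso f
  | AllV x f => 10 :: x :: enc_mso f
  | ExS X f => 11 :: X :: enc_mso f
  | AllS X f => 12 :: X :: enc_mso f
  end.

(* The list of the input arrays:
   - array 0: the sizes n, l, c, number of blocks, length of array 1;
   - array 1: the formula;
   - array 2: the vertex carrying each label;
   - arrays 3 and 4: the adjacency matrix, row after row, and the positions in
     array 3 at which the rows start;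
   - arrays 5 and 6: likewise for the c x n membership matrix of the colour
     classes;
   - arrays 7 and 8: the vertices block after block, and the positions in
     array 7 at which the blocks start, followed by the end of the last one.
   The arrays of row starts make the entries of a matrix accessible in constant
   time without multiplication. *)
Definition enc_input n l c (G : lcgraph n l c) (P : seq (seq 'I_n))
    (phi : mso l c) : seq (seq nat) :=
  [:: [:: n; l; c; size P; size (enc_mso phi)];
      enc_mso phi;
      [seq val (lab G i) | i <- enum 'I_l];
      [seq nat_of_bool (adj G u v) | u <- enum 'I_n, v <- enum 'I_n];
      [seq u * n | u <- iota 0 n];
      [seq nat_of_bool (v \in col G i) | i <- enum 'I_c, v <- enum 'I_n];
      [seq i * n | i <- iota 0 c];
      [seq val v | v <- flatten P];
      [seq sumn (take i (shape P)) | i <- iota 0 (size P).+1]].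

(* The input is already in memory when the program starts (it is not read
   sequentially); everything else is 0. *)
Definition init_store (input : seq (seq nat)) : store :=
  Store (fun _ => 0) (fun a i => nth 0 (nth [::] input a) i).

(* Main.v *)
(** A formula with q_S set quantifiers and q_V vertex quantifiers cannot count the
unlabelled vertices of one type beyond T = 2^q_S * q_V: in an Ehrenfeucht-Fraisse game a vertex
move uses up one vertex of a cell, and a set move splits a cell in two, one half
of which may be chosen as large as half the threshold. So the graph may be
replaced by its kernel, made of the labelled vertices and of T unlabelled
vertices of each block, whose size m <= l + w * T does not depend on n, and the
formula can be evaluated there by brute force, with sets of kernel vertices
represented by the numbers below 2^m. *)

Require Import Defs.
From mathcomp Require Import all_boot.
From mathcomp Require Import zify.
(* eqtype also exports a Sub, which must not hide the constructor of expr. *)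
Import Defs.

Set Implicit Arguments.
Unset Strict Implicit.
Unset Printing Implicit Defensive.

(** The program is fixed while the formula is input, so recursion on the formula becomes a loop over
    an explicit stack of frames. Every loop body is straight-line code whose cost is bounded by a
    constant, so running times reduce to numbers of iterations. The time must not depend on n.
    Memory is 0 at the start, and 0 in [aIdx] already means absent, so nothing of size n is
    initialised; the scan of a block is abandoned after T new vertices, and the vertices it passes
    over are kernel vertices already. T itself is computed without multiplication, by additions and
    doublings during one pass over the formula. In the time bound a set quantifier costs a factor of
    about 2^m and a vertex quantifier one of about m. As m is of order 2^q_S (w+l) q_V, the former
    add about q_S m to the exponent and the latter about q_V log m, which is where log q_V comes
    from. *)

(** * Straight-line code and loops around it *)

Fixpoint stp (p : cmd) (s : store) : store :=
  match p with
  | Skip | While _ _ => s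
  | Assign x e => Store (upd (reg s) x (eval s e)) (arr s)
  | Put a e1 e2 =>
      Store (reg s) (upd (arr s) a (upd (arr s a) (eval s e1) (eval s e2)))
  | Seq p1 p2 => stp p2 (stp p1 s)
  | If e p1 p2 => if eval s e == 0 then stp p2 s else stp p1 s
  end.

(** Excludes [While], at which [stp] and [worst] only have dummy values. *)
Fixpoint loopfree (p : cmd) : bool :=
  match p with
  | Seq p1 p2 | If _ p1 p2 => loopfree p1 && loopfree p2
  | While _ _ => false
  | _ => true
  end.

(** A conditional is charged for both branches: all that matters is a bound independent of the
    store. *)
Fixpoint worst (p : cmd) : nat :=
  match p with
  | Skip | While _ _ => 1
  | Assign _ e => (cost e).+1
  | Put _ e1 e2 => (cost e1 + cost e2).+1
  | Seq p1 p2 => worst p1 + worst p2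
  | If e p1 p2 => (cost e + (worst p1 + worst p2)).+1
  end.

Definition runs (p : cmd) (s : store) (b : nat) (s' : store) : Prop :=
  exists2 t, t <= b & exec p s t s'.

Lemma runs_seq p q s s1 s2 b1 b2 :
  runs p s b1 s1 -> runs q s1 b2 s2 -> runs (Seq p q) s (b1 + b2) s2.
Proof.
case=> t1 le1 ex1 [t2 le2 ex2]; exists (t1 + t2); first exact: leq_add.
exact: ExecSeq ex1 ex2.
Qed.

Lemma runs_loopfree p s : loopfree p -> runs p s (worst p) (stp p s).
Proof.
elim: p s => [|x e|a e1 e2|p IHp q IHq|e p IHp q IHq|//] s /=.
- by move=> _; exists 1 => //; apply: ExecSkip.
- by move=> _; exists (cost e).+1 => //; apply: ExecAssign.
- by move=> _; exists (cost e1 + cost e2).+1 => //; apply: ExecPut.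
- by case/andP=> lp lq; apply: runs_seq (IHp _ lp) (IHq _ lq).
case/andP=> lp lq; case: eqP => [e0|/eqP e0].
  have [t le_t ex] := IHq s lq; exists (cost e + t).+1; last exact: ExecIfFalse.
  by lia.
have [t le_t ex] := IHp s lp; exists (cost e + t).+1; last exact: ExecIfTrue.
by lia.
Qed.

(** Iterations without the final exit test, so that the stretches of the main loop spent on
    different subformulas can be concatenated. Time is recovered from the number of iterations by
    [runs_while]. *)
Inductive reach (e : expr) (p : cmd) : nat -> store -> store -> Prop :=
| Reach0 s : reach e p 0 s s
| ReachS k s s' :
    eval s e != 0 -> reach e p k (stp p s) s' -> reach e p k.+1 s s'.

Lemma reach_trans e p k1 k2 s s1 s2 :
  reach e p k1 s s1 -> reach e p k2 s1 s2 -> reach e p (k1 + k2) s s2.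
Proof.
by elim=> [//|k s3 s4 e0 _ IH] /IH r; rewrite addSn; apply: ReachS.
Qed.

Lemma reach1 e p s : eval s e != 0 -> reach e p 1 s (stp p s).
Proof. by move=> e0; apply: ReachS e0 (Reach0 _ _ _). Qed.

Lemma runs_while e p k s s' :
  loopfree p -> reach e p k s s' -> eval s' e = 0 ->
  runs (While e p) s (k.+1 * (cost e + worst p).+1) s'.
Proof.
move=> lp; elim=> [s1 e0|k1 s1 s2 e0 _ IH /IH [t2 le2 ex2]].
  by exists (cost e).+1; [lia | apply: ExecWhileFalse].
have [t1 le1 ex1] := runs_loopfree s1 lp.
exists (cost e + t1 + t2).+1; last exact: ExecWhileTrue ex1 ex2.
by rewrite mulSn; lia.
Qed.

(** A jump table: the test guarding entry i is [e] truncated-minus i, reached only if all earlier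
    ones were nonzero. Tables are constant, so a dispatch takes constant time. *)
Fixpoint switch (e : expr) (ps : seq cmd) : cmd :=
  if ps is p :: ps' then If e (switch (Sub e (Const 1)) ps') p else Skip.

Lemma stp_switch e ps s : stp (switch e ps) s = stp (nth Skip ps (eval s e)) s.
Proof.
elim: ps e => [|p ps IH] e /=; first by rewrite nth_nil.
by case: eqP => [->|/eqP e0] //; rewrite IH /= subn1; case: (eval s e) e0.
Qed.

(** * The program *)

(* rM counts the kernel vertices found so far and rN is 2 ^ rM; scanning the
   formula sets rD to 2 ^ num_svars and rT to the threshold rD * num_vvars. *)
Notation rV := 0 (only parsing).
Notation rMode := 1 (only parsing).
Notation rPos := 2 (only parsing).
Notation rDep := 3 (only parsing).
Notation rM := 4 (only parsing).
Notation rN := 5 (only parsing).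
Notation rU := 6 (only parsing).
Notation rW := 7 (only parsing).
Notation rT := 8 (only parsing).
Notation rD := 9 (only parsing).
Notation rI := 10 (only parsing).
Notation rJ := 11 (only parsing).
Notation rE := 12 (only parsing).
Notation rC := 13 (only parsing).

(* Entry v of aIdx is one more than the position of vertex v in the array aKer
   of kernel vertices, or 0 if v is not there; aHalf is a table of halves, by
   which the binary digits of a set are read. The arrays from fKind on hold the
   fields of the stack frames, indexed by depth. *)
Notation aIdx := 9 (only parsing).
Notation aKer := 10 (only parsing).
Notation aHalf := 11 (only parsing).
Notation aVar := 12 (only parsing).
Notation fKind := 13 (only parsing).
Notation fVar := 14 (only parsing).
Notation fOld := 15 (only parsing).
Notation fAcc := 16 (only parsing).
Notation fPos := 17 (only parsing).
Notation fLim := 18 (only parsing).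

Definition seqs (ps : seq cmd) : cmd := foldr Seq Skip ps.

Definition inc (x k : nat) : cmd := Assign x (Add (Reg x) (Const k)).

Definition code (k : nat) : expr := Get 1 (Add (Reg rPos) (Const k)).

Definition scan_cond : expr := Sub (Get 0 (Const 4)) (Reg rPos).
(** Indexed by opcode. The invariant is [rT = rD * V] with V the number of vertex quantifiers read,
    so a vertex quantifier adds [rD] to [rT] and a set quantifier doubles both. Atoms are skipped
    whole, lest their operands be read as opcodes. *)
Definition scan_table : seq cmd :=
  let vq := Seq (inc rPos 2) (Assign rT (Add (Reg rT) (Reg rD))) in
  let sq := seqs [:: inc rPos 2; Assign rT (Add (Reg rT) (Reg rT));
                     Assign rD (Add (Reg rD) (Reg rD))] in
  [:: inc rPos 5; inc rPos 5; inc rPos 4; inc rPos 4;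
      inc rPos 1; inc rPos 1; inc rPos 1; inc rPos 1; inc rPos 1;
      vq; vq; sq; sq].
Definition scan_body : cmd := switch (code 0) scan_table.

Definition add_vertex : cmd :=
  seqs [:: Put aKer (Reg rM) (Reg rU); inc rM 1;
           Put aIdx (Reg rU) (Reg rM); Assign rN (Add (Reg rN) (Reg rN))].

Definition label_cond : expr := Sub (Get 0 (Const 1)) (Reg rI).
Definition label_body : cmd :=
  seqs [:: Assign rU (Get 2 (Reg rI)); inc rI 1;
           If (Get aIdx (Reg rU)) Skip add_vertex].

(* The minimum of rC and rE - rJ, by truncated subtraction. *)
Definition in_block : expr :=
  let len := Sub (Reg rE) (Reg rJ) in Sub (Reg rC) (Sub (Reg rC) len).
(** One flat loop does the work of two nested ones, because loop bodies are straight-line code. [rI]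
    is the next block to open, [rJ] and [rE] are the current position and the end of the open block,
    and [rC] is the number of new vertices still to be taken from it. *)
Definition block_cond : expr :=
  Add (Sub (Get 0 (Const 3)) (Reg rI)) in_block.
Definition block_body : cmd :=
  If in_block
    (seqs [:: Assign rU (Get 7 (Reg rJ)); inc rJ 1;
              If (Get aIdx (Reg rU)) Skip
                (Seq add_vertex (Assign rC (Sub (Reg rC) (Const 1))))])
    (seqs [:: Assign rJ (Get 8 (Reg rI)); inc rI 1;
              Assign rE (Get 8 (Reg rI)); Assign rC (Reg rT)]).

(** The machine cannot halve, so halves are tabulated: step i fills the entries 2i and 2i+1 with
    i. *)
Definition half_cond : expr := Sub (Reg rN) (Reg rI).
Definition half_body : cmd :=
  seqs [:: Put aHalf (Add (Reg rI) (Reg rI)) (Reg rI);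
           Put aHalf (Add (Add (Reg rI) (Reg rI)) (Const 1)) (Reg rI);
           inc rI 1].

Definition load_term (k x : nat) : cmd :=
  If (code k)
    (Assign x (Sub (Get aIdx (Get 2 (code k.+1))) (Const 1)))
    (Assign x (Get aVar (Add (code k.+1) (code k.+1)))).

Definition test (e : expr) : cmd :=
  If e (Assign rV (Const 1)) (Assign rV (Const 0)).

Definition return_after (k : nat) : cmd :=
  Seq (inc rPos k) (Assign rMode (Const 1)).

Definition ker (x : nat) : expr := Get aKer (Reg x).

Definition do_edge : cmd :=
  seqs [:: load_term 1 rU; load_term 3 rW;
           test (Get 3 (Add (Get 4 (ker rU)) (ker rW))); return_after 5].

Definition do_equal : cmd :=
  seqs [:: load_term 1 rU; load_term 3 rW;
           test (Add (Sub (Reg rU) (Reg rW)) (Sub (Reg rW) (Reg rU)));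
           Assign rV (Sub (Const 1) (Reg rV)); return_after 5].

Definition do_incol : cmd :=
  seqs [:: load_term 1 rU; test (Get 5 (Add (Get 6 (code 3)) (ker rU)));
           return_after 4].

Definition do_inset : cmd :=
  seqs [:: load_term 1 rU;
           Assign rW (Get aVar (Add (Add (code 3) (code 3)) (Const 1)));
           inc rPos 4; Assign rMode (Const 2)].

Definition push_conn : cmd :=
  seqs [:: Put fKind (Reg rDep) (code 0); inc rDep 1; inc rPos 1].

(** The old value of the variable is kept because a name may be quantified again inside its own
    scope. The accumulator starts at the neutral element of the connective being iterated, which is
    [isall]. *)
Definition push_quant (isset isall : bool) : cmd :=
  let y := Add (Add (code 1) (code 1)) (Const isset) in
  seqs [:: Put fKind (Reg rDep) (code 0); Put fVar (Reg rDep) y;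
           Put fOld (Reg rDep) (Get aVar y);
           Put fAcc (Reg rDep) (Const isall);
           Put fPos (Reg rDep) (Add (Reg rPos) (Const 2));
           Put fLim (Reg rDep) (Reg (if isset then rN else rM));
           Put aVar y (Const 0);
           inc rDep 1; inc rPos 2].

Definition pop : cmd := Assign rDep (Sub (Reg rDep) (Const 1)).
Definition top (a : nat) : expr := Get a (Sub (Reg rDep) (Const 1)).
Definition set_top (a : nat) (e : expr) : cmd :=
  Put a (Sub (Reg rDep) (Const 1)) e.

Definition second_operand : cmd :=
  seqs [:: set_top fAcc (Reg rV);
           set_top fKind (Add (top fKind) (Const 8)); Assign rMode (Const 0)].

(* The body of a quantifier is evaluated once more after the last value, only to
   move rPos past it: with an empty universe nothing else would. *)
Definition next_value (isall : bool) : cmd :=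
  If (Sub (top fLim) (Get aVar (top fVar)))
    (seqs [:: If (Reg rV)
                (if isall then Skip else set_top fAcc (Const 1))
                (if isall then set_top fAcc (Const 0) else Skip);
              Put aVar (top fVar) (Add (Get aVar (top fVar)) (Const 1));
              Assign rPos (top fPos); Assign rMode (Const 0)])
    (seqs [:: Assign rV (top fAcc); Put aVar (top fVar) (top fOld); pop]).

Definition eval_table : seq cmd :=
  [:: do_edge; do_equal; do_incol; do_inset;
      push_conn; push_conn; push_conn; push_conn; push_conn;
      push_quant false false; push_quant false true;
      push_quant true false; push_quant true true].

(* Kinds 13 to 16 are the connectives 5 to 8 once their left operand is known. *)
Definition return_table : seq cmd :=
  let v := Reg rV in let a := top fAcc in
  let yield e := Seq (test e) pop in
  [:: Skip; Skip; Skip; Skip;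
      yield (Sub (Const 1) v);
      second_operand; second_operand; second_operand; second_operand;
      next_value false; next_value true; next_value false; next_value true;
      yield (Sub (Add a v) (Const 1));
      yield (Add a v);
      yield (Add (Sub (Const 1) a) v);
      yield (Sub (Const 1) (Add (Sub a v) (Sub v a)))].

Definition bit_mode : cmd :=
  If (Reg rU)
    (Seq (Assign rW (Get aHalf (Reg rW)))
         (Assign rU (Sub (Reg rU) (Const 1))))
    (Seq (test (Sub (Reg rW) (Add (Get aHalf (Reg rW)) (Get aHalf (Reg rW)))))
         (Assign rMode (Const 1))).

(* In mode 0 a formula is about to be read, in mode 1 the value of one has just
   been found, and in mode 2 the digit rU of the set rW is being looked up; the
   loop stops in mode 1 at depth 0. *)
Definition main_cond : expr :=
  Add (Sub (Const 1) (Reg rMode))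
      (Add (Reg rDep) (Sub (Reg rMode) (Const 1))).
Definition main_body : cmd :=
  switch (Reg rMode)
    [:: switch (code 0) eval_table; switch (top fKind) return_table; bit_mode].

Definition program : cmd :=
  seqs [:: Assign rD (Const 1); While scan_cond scan_body;
           Assign rN (Const 1); While label_cond label_body;
           Assign rI (Const 0); While block_cond block_body;
           Assign rI (Const 0); While half_cond half_body;
           Assign rPos (Const 0); While main_cond main_body].

(** * The main loop *)

Fixpoint at_code (A : nat -> nat) (p : nat) (ks : seq nat) : Prop :=
  if ks is k :: ks' then A p = k /\ at_code A p.+1 ks' else True.

Lemma at_code_cat A p ks1 ks2 :
  at_code A p (ks1 ++ ks2) <->
  at_code A p ks1 /\ at_code A (p + size ks1) ks2.
Proof.
elim: ks1 p => [|k ks IH] p /=; first by rewrite addn0; tauto.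
by rewrite IH addSnnS; tauto.
Qed.

Definition comb (isall a v : bool) : bool := if isall then a && v else a || v.

Lemma foldl_comb isall a (bs : seq bool) :
  foldl (comb isall) a bs =
  if isall then a && all id bs else a || has id bs.
Proof.
elim: bs a => [|b bs IH] a /=; first by case: isall; rewrite ?andbT ?orbF.
by rewrite IH; case: (isall); rewrite /= ?andbA ?orbA.
Qed.

Section Evaluator.
Variables (l c : nat).
(* The arrays 0 to 11 when the main loop starts, and the registers rM and rN. *)
Variable (A : nat -> nat -> nat) (m N : nat).

(** [tval], [last_bit] and [evl] describe what the loop computes in terms of the raw arrays, so that
    the machine is verified without any graph in sight; [evl_sat] later gives these values their
    meaning. *)
Definition tval (env : nat -> nat) (t : term l) : nat :=
  match t with
  | Var x => env (x + x)
  | Lab i => A 9 (A 2 i) - 1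
  end.

Definition last_bit (s : nat) : bool := s - (A 11 s + A 11 s) != 0.

(* Vertex variable x is stored at index 2x of the environment, and set variable
   X at index 2X + 1. *)
Fixpoint evl (env : nat -> nat) (phi : mso l c) : bool :=
  match phi with
  | Edge s t => A 3 (A 4 (A 10 (tval env s)) + A 10 (tval env t)) != 0
  | Equal s t => tval env s == tval env t
  | InCol t i => A 5 (A 6 i + A 10 (tval env t)) != 0
  | InSet t X => last_bit (iter (tval env t) (A 11) (env (X + X + 1)))
  | Not f => ~~ evl env f
  | Bin o f g => conn_sem o (evl env f) (evl env g)
  | ExV x f => has (fun i => evl (upd env (x + x) i) f) (iota 0 m)
  | AllV x f => all (fun i => evl (upd env (x + x) i) f) (iota 0 m)
  | ExS X f => has (fun i => evl (upd env (X + X + 1) i) f) (iota 0 N)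
  | AllS X f => all (fun i => evl (upd env (X + X + 1) i) f) (iota 0 N)
  end.

(** Membership in a set takes one step to read the atom, at most m shifts and one test, and all
    atoms are charged alike. A quantifier takes one push and, for each value and the extra final
    run, the body and one return. A connective takes a push and a return per operand. *)
Fixpoint iters (phi : mso l c) : nat :=
  match phi with
  | Edge _ _ | Equal _ _ | InCol _ _ | InSet _ _ => m.+2
  | Not f => (iters f).+2
  | Bin _ f g => (iters f + iters g).+3
  | ExV _ f | AllV _ f => (m.+1 * (iters f).+1).+1
  | ExS _ f | AllS _ f => (N.+1 * (iters f).+1).+1
  end.

Definition cfg (s : store) (mode p d : nat) (env : nat -> nat) : Prop :=
  [/\ forall a, a < 12 -> arr s a = A a,
      reg s rM = m /\ reg s rN = N,
      [/\ reg s rMode = mode, reg s rPos = p & reg s rDep = d] &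
      arr s aVar =1 env].

(** Concerns the frame fields only: the arrays up to 12 are governed by [cfg]. *)
Definition same_below (d : nat) (s s' : store) : Prop :=
  forall a k, 12 < a -> k < d -> arr s' a k = arr s a k.

Lemma same_below_trans d s1 s2 s3 :
  same_below d s1 s2 -> same_below d s2 s3 -> same_below d s1 s3.
Proof. by move=> h1 h2 a k ha hk; rewrite h2 // h1. Qed.

Lemma same_belowS d s1 s2 : same_below d.+1 s1 s2 -> same_below d s1 s2.
Proof. by move=> h a k ha hk; rewrite h //; lia. Qed.

Notation mreach := (reach main_cond main_body).

Lemma cond_eval s p d env : cfg s 0 p d env -> eval s main_cond != 0.
Proof. by case=> _ _ [/= -> _ _] _. Qed.

Lemma cond_bit s p d env : cfg s 2 p d env -> eval s main_cond != 0.
Proof. by case=> _ _ [/= -> _ ->] _; lia. Qed.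

Lemma cond_return s p d env : cfg s 1 p d.+1 env -> eval s main_cond != 0.
Proof. by case=> _ _ [/= -> _ ->] _; lia. Qed.

Lemma stp_eval s p d env op : cfg s 0 p d env -> A 1 p = op ->
  stp main_body s = stp (nth Skip eval_table op) s.
Proof.
case=> hA _ [hm hp _] _ hop; rewrite /main_body stp_switch [eval _ _]/= hm.
by rewrite (_ : nth _ _ _ = switch (code 0) eval_table) // stp_switch
  [eval _ _]/= hp addn0 hA // hop.
Qed.

Lemma stp_return s p d env kind : cfg s 1 p d.+1 env -> arr s fKind d = kind ->
  stp main_body s = stp (nth Skip return_table kind) s.
Proof.
case=> hA _ [hm hp hd] _ hk; rewrite /main_body stp_switch [eval _ _]/= hm.
by rewrite (_ : nth _ _ _ = switch (top fKind) return_table) // stp_switch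
  [eval _ _]/= hd subn1 hk.
Qed.

Lemma size_enc_term (t : term l) : size (enc_term t) = 2.
Proof. by case: t. Qed.

Lemma stp_load_term s p mode d env t k x :
  cfg s mode p d env -> at_code (A 1) (p + k) (enc_term t) ->
  stp (load_term k x) s = Store (upd (reg s) x (tval env t)) (arr s).
Proof.
case=> hA _ [hm hp _] hv; case: t => [y|i] /= [h1 [h2 _]].
  by rewrite hp (hA 1) // h1 /= addnS h2 hv.
by rewrite hp (hA 1) // (hA 2) // (hA 9) // h1 /= addnS h2.
Qed.

Lemma stp_test e s :
  stp (test e) s = Store (upd (reg s) rV (eval s e != 0)) (arr s).
Proof. by rewrite /=; case: eqP. Qed.

Lemma cfg_reg s mode p d env x v : x \notin [:: rMode; rPos; rDep; rM; rN] ->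
  cfg s mode p d env ->
  cfg (Store (upd (reg s) x v) (arr s)) mode p d env.
Proof.
rewrite !inE !negb_or => /and5P [x1 x2 x3 x4 x5] [hA [hM hN] [hm hp hd] hv].
by split=> //=; rewrite /upd ![_ == x]eq_sym; split;
   rewrite ?(negPf x1, negPf x2, negPf x3, negPf x4, negPf x5).
Qed.

Lemma stp_seqs p ps s : stp (seqs (p :: ps)) s = stp (seqs ps) (stp p s).
Proof. by []. Qed.

Lemma stp_seqs0 s : stp (seqs [::]) s = s.
Proof. by []. Qed.

Lemma cfg_return s p d env k : cfg s 0 p d env ->
  cfg (stp (return_after k) s) 1 (p + k) d env.
Proof. by case=> hA [hM hN] [hm hp hd] hv; split; rewrite //= /upd /= ?hp. Qed.

(** The contract for evaluating one subformula. Used at depth [d.+1], it guarantees that the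
    caller's frame, stored at index d, is intact on return. *)
Definition returns (k : nat) (s : store) (p d : nat) (env : nat -> nat)
    (v : bool) : Prop :=
  exists s', [/\ mreach k s s', cfg s' 1 p d env, reg s' rV = nat_of_bool v
               & same_below d s s'].

Lemma returns_trans k1 k2 s s1 p d env v : mreach k1 s s1 ->
  same_below d s s1 -> returns k2 s1 p d env v -> returns (k1 + k2) s p d env v.
Proof.
move=> r1 b1 [s2 [r2 c2 v2 b2]]; exists s2; split=> //.
  exact: reach_trans r1 r2.
exact: same_below_trans b1 b2.
Qed.

Lemma returns_here s p d env v :
  cfg s 1 p d env -> reg s rV = nat_of_bool v -> returns 0 s p d env v.
Proof. by move=> cs vs; exists s; split=> //; apply: Reach0. Qed.

Lemma returns_step k s p d env v : eval s main_cond != 0 ->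
  same_below d s (stp main_body s) ->
  returns k (stp main_body s) p d env v -> returns k.+1 s p d env v.
Proof. by move=> e0; apply: (@returns_trans 1); apply: reach1. Qed.

Lemma run_bit j s p d env : cfg s 2 p d env -> reg s rU = j ->
  returns j.+1 s p d env (last_bit (iter j (A 11) (reg s rW))).
Proof.
elim: j s => [|j IH] s cs sU; have [hA [hM hN] [hm hp hd] hv] := cs.
  apply: returns_step; first exact: cond_bit cs.
    rewrite /main_body stp_switch [eval _ _]/= hm /= sU.
    by rewrite /=; case: eqP.
  apply: returns_here.
    rewrite /main_body stp_switch [eval _ _]/= hm /= sU /=.
    by case: eqP => _; split.
  rewrite /main_body stp_switch [eval _ _]/= hm /= sU /= (hA 11) //.
  by rewrite /last_bit /=; case: eqP.
have Es : stp main_body s = Store (upd (upd (reg s) rW (A 11 (reg s rW))) rU j)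
                              (arr s).
  rewrite /main_body stp_switch [eval _ _]/= hm /= sU /= (hA 11) //.
  by rewrite /= /upd /= sU subn1.
apply: returns_step; first exact: cond_bit cs.
  by rewrite Es.
rewrite Es iterSr.
by apply: IH; rewrite //; do 2!apply: cfg_reg => //.
Qed.

Lemma run_atom op s p d env len r v :
  cfg s 0 p d env -> A 1 p = op ->
  stp (nth Skip [:: do_edge; do_equal; do_incol] op) s =
    stp (return_after len) (Store r (arr s)) ->
  cfg (Store r (arr s)) 0 p d env -> r rV = nat_of_bool v -> op < 3 ->
  returns 1 s (p + len) d env v.
Proof.
move=> cs hop E cr rv lt_op.
have Es : stp main_body s = stp (return_after len) (Store r (arr s)).
  by rewrite (stp_eval cs hop) -E; case: op lt_op {hop E} => [|[|[]]].
apply: returns_step (cond_eval cs) _ _; rewrite Es //.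
by apply: returns_here; first exact: cfg_return.
Qed.

Lemma run_edge s p d env (t u : term l) : cfg s 0 p d env ->
  at_code (A 1) p (enc_mso (Edge c t u)) ->
  returns 1 s (p + 5) d env (evl env (Edge c t u)).
Proof.
move=> cs [op /at_code_cat []]; rewrite size_enc_term -(addn1 p) => ct cu.
have c1 := @cfg_reg _ _ _ _ _ rU (tval env t) isT cs.
have c2 := @cfg_reg _ _ _ _ _ rW (tval env u) isT c1.
rewrite -addnA in cu; have [hA _ _ _] := c2.
apply: (run_atom cs op _ (@cfg_reg _ _ _ _ _ rV
  (evl env (Edge c t u)) isT c2)) => //.
rewrite [nth _ _ _]/= /do_edge !stp_seqs stp_seqs0 (stp_load_term _ cs ct).
rewrite (stp_load_term _ c1 cu) stp_test /= /upd /=.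
by have /= := (hA 3, hA 4, hA 10) => -[[-> // -> //] -> //].
Qed.

Lemma run_equal s p d env (t u : term l) : cfg s 0 p d env ->
  at_code (A 1) p (enc_mso (Equal c t u)) ->
  returns 1 s (p + 5) d env (evl env (Equal c t u)).
Proof.
move=> cs [op /at_code_cat []]; rewrite size_enc_term -(addn1 p) => ct cu.
have c1 := @cfg_reg _ _ _ _ _ rU (tval env t) isT cs.
have c2 := @cfg_reg _ _ _ _ _ rW (tval env u) isT c1.
have c3 v := @cfg_reg _ _ _ _ _ rV v isT c2.
rewrite -addnA in cu; have [hA _ _ _] := c2.
apply: (run_atom cs op _ (@cfg_reg _ _ _ _ _ rV (evl env (Equal c t u)) isT
  (c3 (tval env t != tval env u)))) => //.
rewrite [nth _ _ _]/= /do_equal !stp_seqs stp_seqs0 (stp_load_term _ cs ct).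
rewrite (stp_load_term _ c1 cu) stp_test /= /upd /=.
have -> : (tval env t - tval env u + (tval env u - tval env t) != 0)
          = (tval env t != tval env u) by lia.
by case: eqP.
Qed.

Lemma run_incol s p d env (t : term l) (i : 'I_c) : cfg s 0 p d env ->
  at_code (A 1) p (enc_mso (InCol t i)) ->
  returns 1 s (p + 4) d env (evl env (InCol t i)).
Proof.
rewrite /= -cats1 => cs [op /at_code_cat []].
rewrite size_enc_term -(addn1 p) -addnA => ct [ci _].
have c1 := @cfg_reg _ _ _ _ _ rU (tval env t) isT cs.
have [hA _ [_ hp _] _] := cs.
apply: (run_atom cs op _ (@cfg_reg _ _ _ _ _ rV
  (evl env (InCol t i)) isT c1)) => //.
rewrite [nth _ _ _]/= /do_incol !stp_seqs stp_seqs0 (stp_load_term _ cs ct).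
by rewrite stp_test /= /upd /= hp (hA 1) // ci (hA 5) // (hA 6) // (hA 10).
Qed.

Lemma run_inset s p d env (t : term l) X : cfg s 0 p d env ->
  at_code (A 1) p (enc_mso (InSet c t X)) ->
  returns (tval env t).+2 s (p + 4) d env (evl env (InSet c t X)).
Proof.
rewrite /= -cats1 => cs [op /at_code_cat []].
rewrite size_enc_term -(addn1 p) -addnA => ct [ci _].
have c1 := @cfg_reg _ _ _ _ _ rU (tval env t) isT cs.
have [hA [hM hN] [hm hp hd] hv] := cs.
have Es : stp main_body s =
    Store (upd (upd (upd (upd (reg s) rU (tval env t)) rW (env (X + X + 1)))
      rPos (p + 4)) rMode 2) (arr s).
  rewrite (stp_eval cs op) [nth _ _ _]/= /do_inset !stp_seqs stp_seqs0.
  rewrite (stp_load_term _ cs ct) /= /upd /= hp (hA 1) // ci.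
  by rewrite hv.
apply: returns_step (cond_eval cs) _ _; rewrite Es //.
by apply: run_bit.
Qed.

Lemma run_push s p d env op : cfg s 0 p d env -> A 1 p = op ->
  3 < op -> op < 9 ->
  exists s1, [/\ mreach 1 s s1, cfg s1 0 p.+1 d.+1 env, arr s1 fKind d = op
               & same_below d s s1].
Proof.
move=> cs hop op3 op9; exists (stp main_body s).
have Es : stp main_body s = stp push_conn s.
  by rewrite (stp_eval cs hop); move: op op3 op9 {hop}; do 9?case=> //.
rewrite Es; have [hA [hM hN] [hm hp hd] hv] := cs; split.
- by rewrite -Es; apply: reach1 (cond_eval cs).
- split; rewrite //= /upd /= ?hd ?hp ?addn1 //.
  move=> a lta; have -> : (a == 13) = false by lia.
  exact: hA.
- by rewrite /= /upd /= hd hp addn0 hA // eqxx.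
move=> a k a12 ltk; rewrite /= /upd /= hd.
by case: eqP => // ->; rewrite ltn_eqF.
Qed.

Lemma run_yield s p d env kind e v :
  cfg s 1 p d.+1 env -> arr s fKind d = kind ->
  nth Skip return_table kind = Seq (test e) pop -> (eval s e != 0) = v ->
  returns 1 s p d env v.
Proof.
move=> cs hk Ek ev; have Es := stp_return cs hk.
have [hA [hM hN] [hm hp hd] hv] := cs.
rewrite {}Ek [stp _ _ in RHS]/= -/(test e) in Es.
have {}Es : stp main_body s = Store (upd (upd (reg s) rV v) rDep d) (arr s).
  by rewrite Es -ev; case: eqP; rewrite /= /upd /= hd subn1.
apply: returns_step (cond_return cs) _ _; rewrite Es //.
by apply: returns_here => //; split.
Qed.

Lemma run_not k s p d env f :
  (forall s1, cfg s1 0 p.+1 d.+1 env ->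
    exists2 k1, k1 <= k
      & returns k1 s1 (p.+1 + size (enc_mso f)) d.+1 env (evl env f)) ->
  cfg s 0 p d env -> A 1 p = 4 ->
  exists2 k1, k1 <= k.+2
    & returns k1 s (p + size (enc_mso (Not f))) d env (evl env (Not f)).
Proof.
move=> IH cs hop.
have [s1 [r1 c1 k1 b1]] := run_push cs hop isT isT.
have [j lej [s2 [r2 c2 v2 b2]]] := IH _ c1.
exists (1 + (j + 1)); first by lia.
apply: returns_trans r1 b1 _; apply: returns_trans r2 (same_belowS b2) _.
rewrite /= addnS -addSn; apply: (run_yield c2 (kind := 4)) => //.
  by rewrite b2.
by rewrite /= v2; case: (evl env f).
Qed.

Lemma enc_conn_bounds o : 4 < enc_conn o < 9.
Proof. by case: o. Qed.

Lemma run_bin k k' s p d env o f g :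
  (forall s1, cfg s1 0 p.+1 d.+1 env ->
    exists2 k1, k1 <= k
      & returns k1 s1 (p.+1 + size (enc_mso f)) d.+1 env (evl env f)) ->
  (forall s1, cfg s1 0 (p.+1 + size (enc_mso f)) d.+1 env ->
    exists2 k1, k1 <= k'
      & returns k1 s1 (p.+1 + size (enc_mso f) + size (enc_mso g)) d.+1 env
          (evl env g)) ->
  cfg s 0 p d env -> A 1 p = enc_conn o ->
  exists2 k1, k1 <= (k + k').+3
    & returns k1 s (p + size (enc_mso (Bin o f g))) d env (evl env (Bin o f g)).
Proof.
move=> IHf IHg cs hop; have /andP [o4 o9] := enc_conn_bounds o.
have [s1 [r1 c1 k1 b1]] := run_push cs hop (ltnW o4) o9.
have [j lej [s2 [r2 c2 v2 b2]]] := IHf _ c1.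
have k2 : arr s2 fKind d = enc_conn o by rewrite b2.
have Es3 : stp main_body s2 = stp second_operand s2.
  by rewrite (stp_return c2 k2); case: (o).
have [hA [hM hN] [hm hp hd] hv] := c2.
have c3 : cfg (stp main_body s2) 0 (p.+1 + size (enc_mso f)) d.+1 env.
  rewrite Es3; split; rewrite //= /upd /= ?hd ?hp ?addn1 //.
  move=> a lta; have [-> ->] : (a == 13) = false /\ (a == 16) = false by lia.
  exact: hA.
have k3 : arr (stp main_body s2) fKind d = enc_conn o + 8.
  by rewrite Es3 /= /upd /= hd subn1 /= eqxx k2.
have a3 : arr (stp main_body s2) fAcc d = evl env f.
  by rewrite Es3 /= /upd /= hd subn1 /= eqxx v2.
have b3 : same_below d s2 (stp main_body s2).
  move=> a i a12 lti; rewrite Es3 /= /upd /= hd subn1 /=.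
  case: (a =P 13) => [->|_]; first by rewrite ltn_eqF.
  by case: (a =P 16) => [->|_] //; rewrite ltn_eqF.
have [j' lej' [s4 [r4 c4 v4 b4]]] := IHg _ c3.
exists (1 + (j + (1 + (j' + 1)))); first by lia.
apply: returns_trans r1 b1 _; apply: returns_trans r2 (same_belowS b2) _.
apply: returns_trans (reach1 _ (cond_return c2)) b3 _.
apply: returns_trans r4 (same_belowS b4) _.
have k4 : arr s4 fKind d = enc_conn o + 8 by rewrite b4.
have a4 : arr s4 fAcc d = evl env f by rewrite b4.
rewrite /= size_cat addnS addnA -!addSn.
have [_ _ [_ _ hd4] _] := c4.
case: o {hop o4 o9 k1 k2 k3 Es3 IHf IHg c3 a3} k4 => k4;
  apply: (run_yield c4 k4) => //=; rewrite hd4 (subn1 d.+1) /= v4 a4;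
  by case: (evl env f); case: (evl env g).
Qed.

Definition frame (s : store) (d op y old acc pos lim : nat) : Prop :=
  [/\ arr s fKind d = op, arr s fVar d = y, arr s fOld d = old
    & [/\ arr s fAcc d = acc, arr s fPos d = pos & arr s fLim d = lim]].

Lemma frame_same s s' d op y old acc pos lim : same_below d.+1 s s' ->
  frame s d op y old acc pos lim -> frame s' d op y old acc pos lim.
Proof. by move=> b [? ? ? [? ? ?]]; split; [..|split]; rewrite b. Qed.

(** The accumulator holds the result for the values before j, and the value of the body at j is
    merged in when the next one starts. The premise includes [j = lim]: this is the extra final run,
    whose result is discarded. *)
Lemma run_values (op y lim pos q d k : nat) (isall : bool) env
    (F : nat -> bool) :
  nth Skip return_table op = next_value isall ->
  (forall j s, j <= lim -> cfg s 0 pos d.+1 (upd env y j) ->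
     exists2 k1, k1 <= k & returns k1 s q d.+1 (upd env y j) (F j)) ->
  forall r s j acc, j + r = lim -> cfg s 0 pos d.+1 (upd env y j) ->
    frame s d op y (env y) (nat_of_bool acc) pos lim ->
    exists2 k1, k1 <= r.+1 * k.+1 &
      returns k1 s q d env (foldl (comb isall) acc (map F (iota j r))).
Proof.
move=> Eop IH; elim=> [|r IHr] s j acc jr cs fs.
  have [|k1 le1 [s2 [r2 c2 v2 b2]]] := IH j s _ cs; first by lia.
  have [f1 f2 f3 [f4 f5 f6]] := frame_same b2 fs.
  exists (k1 + 1); first by lia.
  apply: returns_trans r2 (same_belowS b2) _.
  have Es := stp_return c2 f1; rewrite {}Eop in Es.
  have [hA [hM hN] [hm hp hd] hv] := c2.
  have {}Es : stp main_body s2 = Store (upd (upd (reg s2) rV acc) rDep d)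
      (upd (arr s2) aVar (upd (arr s2 aVar) y (env y))).
    rewrite Es /= hd (subn1 d.+1) /= f2 f6 hv {1}/upd eqxx.
    have -> : lim - j == 0 by lia.
    by rewrite /= /upd /= hd (subn1 d.+1) /= f2 f3 f4.
  apply: returns_step (cond_return c2) _ _; rewrite Es.
    by move=> a i a12 _; rewrite /= /upd gtn_eqF.
  apply: returns_here => //; split=> //.
    by move=> a lta; rewrite /= /upd ltn_eqF // hA.
  move=> i; rewrite /= /upd /=; case: eqP => [->|/eqP ne] //.
  by rewrite hv /upd (negPf ne).
have [|k1 le1 [s2 [r2 c2 v2 b2]]] := IH j s _ cs; first by lia.
have [f1 f2 f3 [f4 f5 f6]] := frame_same b2 fs.
have Es := stp_return c2 f1; rewrite {}Eop in Es.
have [hA [hM hN] [hm hp hd] hv] := c2.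
set s3 := stp main_body s2 in Es.
pose acc' := comb isall acc (F j).
have [regs3 low3 arrs3] : [/\ reg s3 = upd (upd (reg s2) rPos pos) rMode 0,
    forall a, a < 12 -> arr s3 a = arr s2 a &
    forall a i, arr s3 a i = if a == aVar then upd (arr s2 aVar) y j.+1 i
      else if (a == fAcc) && (i == d) then nat_of_bool acc' else arr s2 a i].
  have updy : upd env y j y = j by rewrite /upd eqxx.
  rewrite Es /= hd (subn1 d.+1) /= f2 f6 hv updy.
  have -> : (lim - j == 0) = false by lia.
  rewrite v2 /acc' /comb; case: (isall); case: (F j) => /=;
    rewrite /upd /= hd (subn1 d.+1) /= f2 f5 addn1 hv updy;
    (split=> // a;
     [ by move=> a12; rewrite (ltn_eqF a12) ?(ltn_eqF (leq_trans a12 _))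
     | move=> i; case: (a =P 12) => [_|_] //=; case: (a =P 16) => [a16|_] //=;
       case: (i =P d) => [id|_] //=;
       by rewrite ?a16 ?id ?f4 ?andbT ?andbF ?orbT ?orbF ]).
have c3 : cfg s3 0 pos d.+1 (upd env y j.+1).
  split; rewrite ?regs3 //.
    by move=> a lta; rewrite low3 // hA.
  move=> i; rewrite arrs3 /= /upd; case: eqP => [_|/eqP ne] //.
  by rewrite hv /upd (negPf ne).
have fr3 : frame s3 d op y (env y) acc' pos lim.
  by split; [..|split]; rewrite arrs3 ?eqxx.
have b3 : same_below d s2 s3.
  by move=> a i a12 lti; rewrite arrs3 gtn_eqF // (ltn_eqF lti) andbF.
have [|k2 le2 R3] := IHr s3 j.+1 acc' _ c3 fr3; first by lia.
exists (k1 + (1 + k2)); first by rewrite (mulSn r.+1); lia.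
apply: returns_trans r2 (same_belowS b2) _.
exact: returns_trans (reach1 _ (cond_return c2)) b3 R3.
Qed.

Lemma run_quant (op x k q : nat) (isset isall : bool) s p d env
    (F : nat -> bool) :
  let y := x + x + isset in let lim := if isset then N else m in
  nth Skip eval_table op = push_quant isset isall ->
  nth Skip return_table op = next_value isall ->
  (forall j s1, j <= lim -> cfg s1 0 p.+2 d.+1 (upd env y j) ->
     exists2 k1, k1 <= k & returns k1 s1 q d.+1 (upd env y j) (F j)) ->
  cfg s 0 p d env -> A 1 p = op -> A 1 p.+1 = x ->
  exists2 k1, k1 <= (lim.+1 * k.+1).+1 &
    returns k1 s q d env (foldl (comb isall) isall (map F (iota 0 lim))).
Proof.
move=> y lim Ee Er IH cs hop hx.
have [hA [hM hN] [hm hp hd] hv] := cs.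
have Es := stp_eval cs hop; rewrite Ee in Es.
set s1 := stp main_body s in Es.
have A1 : arr s 1 = A 1 by rewrite hA.
have [c1 f1 b1] : [/\ cfg s1 0 p.+2 d.+1 (upd env y 0),
    frame s1 d op y (env y) isall p.+2 lim & same_below d s s1].
  have rlim : reg s (if isset then 5 else 4) = lim.
    by rewrite /lim; case: (isset).
  rewrite Es /push_quant; split.
  - split; rewrite //= /upd /= ?hd ?hp ?A1 ?addn1 ?addn2 //.
    + move=> a a12; do 7?[rewrite (_ : (a == _) = false); last by lia].
      exact: hA.
    + by move=> i; rewrite hx hv.
  - by split; [..|split]; rewrite /= /upd /= ?hd ?hp ?A1 ?addn0 ?addn1 ?addn2
      ?eqxx ?hx ?hop ?hv // rlim.
  move=> a i a12 lti; rewrite /= /upd /= hd gtn_eqF //.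
  by do 6![case: ifP => [/eqP ->|_]; first by rewrite (ltn_eqF lti)].
have [|k1 le1 R1] :=
  @run_values op y lim p.+2 q d k isall env F Er IH lim s1 0 isall _ c1 f1.
  by [].
exists k1.+1; first by lia.
exact: returns_trans (reach1 _ (cond_eval cs)) b1 R1.
Qed.

Lemma foldl_has (g : nat -> bool) r :
  foldl (comb false) false (map g r) = has g r.
Proof. by rewrite foldl_comb has_map. Qed.

Lemma foldl_all (g : nat -> bool) r :
  foldl (comb true) true (map g r) = all g r.
Proof. by rewrite foldl_comb all_map. Qed.

Hypothesis lab_le : forall i : 'I_l, A 9 (A 2 i) - 1 <= m.

Lemma tval_le env (t : term l) :
  (forall x, env (x + x) <= m) -> tval env t <= m.
Proof. by case: t => [x|i] /=. Qed.

(** Vertex values are bounded by m inclusively, since the extra run of a quantified body uses the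
    value m. A bound is needed at all because looking up a digit takes as many steps as the value of
    the term. *)
Lemma run_mso phi s p d env : cfg s 0 p d env ->
  at_code (A 1) p (enc_mso phi) -> (forall x, env (x + x) <= m) ->
  exists2 k, k <= iters phi &
    returns k s (p + size (enc_mso phi)) d env (evl env phi).
Proof.
have pos2 a b : a + b.+2 = a.+2 + b by rewrite !addnS !addSn.
elim: phi s p d env => [t u|t u|t i|t X|f IH|o f IHf g IHg|x f IH|x f IH|X f IH
  |X f IH] s p d env cs hc he.
- exists 1; first by [].
  by rewrite /= size_cat !size_enc_term; apply: run_edge.
- exists 1; first by [].
  by rewrite /= size_cat !size_enc_term; apply: run_equal.
- exists 1; first by [].
  by rewrite [size _]/= size_rcons !size_enc_term; apply: run_incol.
- exists (tval env t).+2; first by rewrite !ltnS tval_le.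
  by rewrite [size _]/= size_rcons !size_enc_term; apply: run_inset.
- case: hc => op hc; apply: run_not => // s1 c1; exact: IH.
- case: hc => op /at_code_cat [cf cg]; apply: run_bin => // s1 c1.
    exact: IHf.
  exact: IHg.
- case: hc => op [hx hc]; rewrite [size _]/= [evl _ _]/= -foldl_has pos2
    -(addn0 (x + x)).
  apply: (@run_quant 9 x _ _ false false _ _ _ _ _ erefl erefl _ cs op hx)
    => j s1 lej c1; apply: (IH _ _ _ _ c1 hc).
  by move=> z; rewrite /upd; case: eqP.
- case: hc => op [hx hc]; rewrite [size _]/= [evl _ _]/= -foldl_all pos2
    -(addn0 (x + x)).
  apply: (@run_quant 10 x _ _ false true _ _ _ _ _ erefl erefl _ cs op hx)
    => j s1 lej c1; apply: (IH _ _ _ _ c1 hc).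
  by move=> z; rewrite /upd; case: eqP.
- case: hc => op [hX hc]; rewrite [size _]/= [evl _ _]/= -foldl_has pos2.
  apply: (@run_quant 11 X _ _ true false _ _ _ _ _ erefl erefl _ cs op hX)
    => j s1 lej c1; apply: (IH _ _ _ _ c1 hc).
  (* Set variables live at odd indices, so the bound at even ones is unaffected. *)
  by move=> z; rewrite /upd; case: eqP => // ?; lia.
- case: hc => op [hX hc]; rewrite [size _]/= [evl _ _]/= -foldl_all pos2.
  apply: (@run_quant 12 X _ _ true true _ _ _ _ _ erefl erefl _ cs op hX)
    => j s1 lej c1; apply: (IH _ _ _ _ c1 hc).
  by move=> z; rewrite /upd; case: eqP => // ?; lia.
Qed.

(** Each quantifier multiplies the count by its range plus one, and the additive overheads are paid
    by the growth of [mso_len]. At a connective the numbers of quantifiers add up, so the powers of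
    either operand are bounded by the product of both. *)
Lemma iters_le phi :
  iters phi <=
    m.+3 * mso_len phi * (m.+1 ^ num_vvars phi * N.+1 ^ num_svars phi).
Proof.
have ge2 X : 0 < X -> 2 <= m.+3 * X.
  by move=> X0; apply: leq_trans (leq_pmulr _ X0).
have quant L I len X : I <= m.+3 * len * X -> 0 < X ->
    (L.+1 * I.+1).+1 <= m.+3 * len.+2 * (L.+1 * X).
  move=> leI X0; apply: (@leq_trans (L.+1 * (I + 2))).
    by rewrite mulnDr mulnS; lia.
  rewrite (mulnCA _ L.+1) leq_mul2l -(addn2 len) mulnDr mulnDl /= leq_add //.
  by rewrite -mulnA ge2 // muln_gt0.
have pos a b : 0 < m.+1 ^ a * N.+1 ^ b by rewrite muln_gt0 !expn_gt0.
elim: phi => [t u|t u|t i|t X|f IH|o f IHf g IHg|x f IH|x f IH|X f IH|X f IH] /=.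
- by rewrite !expn0; lia.
- by rewrite !expn0; lia.
- by rewrite !expn0; lia.
- by rewrite !expn0; lia.
- rewrite mulnS mulnDl -(addn2 (iters f)) addnC leq_add // ge2 //; exact: pos.
- set F := _ ^ _ * _ ^ _ in IHf; set H := _ ^ _ * _ ^ _ in IHg.
  have F0 : 0 < F by apply: pos.
  have H0 : 0 < H by apply: pos.
  have -> : m.+1 ^ (num_vvars f + num_vvars g) *
      N.+1 ^ (num_svars f + num_svars g) = F * H by rewrite !expnD mulnACA.
  rewrite -(addn3 (iters f + iters g)) mulnS mulnDr addnC mulnDl leq_add //.
    by rewrite -[3]muln1; apply: leq_mul => //; rewrite muln_gt0 F0.
  rewrite mulnDl leq_add //.
    by apply: leq_trans IHf _; rewrite leq_mul2l leq_pmulr ?orbT.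
  by apply: leq_trans IHg _; rewrite leq_mul2l leq_pmull ?orbT.
- by rewrite expnS -(mulnA m.+1); apply: quant.
- by rewrite expnS -(mulnA m.+1); apply: quant.
- by rewrite expnS (mulnCA (m.+1 ^ _)); apply: quant.
- by rewrite expnS (mulnCA (m.+1 ^ _)); apply: quant.
Qed.

End Evaluator.

(** * Computing the kernel *)

(** Syntactic frame conditions: that a loop preserves a given register or array is then decided by
    computation. *)
Fixpoint wregs (p : cmd) : seq nat :=
  match p with
  | Assign x _ => [:: x]
  | Seq p q | If _ p q => wregs p ++ wregs q
  | _ => [::]
  end.

Fixpoint warrs (p : cmd) : seq nat :=
  match p with
  | Put a _ _ => [:: a]
  | Seq p q | If _ p q => warrs p ++ warrs q
  | _ => [::]
  end.

Lemma stp_reg p s x : x \notin wregs p -> reg (stp p s) x = reg s x.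
Proof.
elim: p s => [|y e|a e1 e2|p IHp q IHq|e p IHp q IHq|//] s //=.
- by rewrite inE /upd => /negPf ->.
- by rewrite mem_cat negb_or => /andP [np nq]; rewrite IHq // IHp.
rewrite mem_cat negb_or => /andP [np nq].
by case: ifP => _; [rewrite IHq|rewrite IHp].
Qed.

Lemma stp_arr p s a : a \notin warrs p -> arr (stp p s) a = arr s a.
Proof.
elim: p s => [|y e|b e1 e2|p IHp q IHq|e p IHp q IHq|//] s //=.
- by rewrite inE /upd => /negPf ->.
- by rewrite mem_cat negb_or => /andP [np nq]; rewrite IHq // IHp.
rewrite mem_cat negb_or => /andP [np nq].
by case: ifP => _; [rewrite IHq|rewrite IHp].
Qed.

Lemma reach_reg e p k s s' x :
  x \notin wregs p -> reach e p k s s' -> reg s' x = reg s x.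
Proof. by move=> nx; elim=> // j s1 s2 _ _ ->; apply: stp_reg. Qed.

Lemma reach_arr e p k s s' a :
  a \notin warrs p -> reach e p k s s' -> arr s' a = arr s a.
Proof. by move=> nx; elim=> // j s1 s2 _ _ ->; apply: stp_arr. Qed.

Lemma scan_step s p op cs : at_code (arr s 1) p (op :: cs) ->
  reg s rPos = p -> p < arr s 0 4 ->
  reach scan_cond scan_body 1 s (stp (nth Skip scan_table op) s).
Proof.
move=> [hop _] hp hl.
have <- : stp scan_body s = stp (nth Skip scan_table op) s.
  by rewrite /scan_body stp_switch [eval _ _]/= hp addn0 hop.
by apply: reach1; rewrite /= hp; lia.
Qed.

(** Stated for arbitrary initial [rD] and V, because the right operand of a connective is scanned
    with the values left by the left one. *)
Definition scanned l c (phi : mso l c) s p V : Prop :=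
  exists k s', [/\ k <= mso_len phi, reach scan_cond scan_body k s s',
    reg s' rPos = p + size (enc_mso phi),
    reg s' rD = reg s rD * 2 ^ num_svars phi &
    reg s' rT = reg s' rD * (V + num_vvars phi)].

Lemma run_scan l c (phi : mso l c) s p V :
  at_code (arr s 1) p (enc_mso phi) -> reg s rPos = p ->
  p + size (enc_mso phi) <= arr s 0 4 -> reg s rT = reg s rD * V ->
  scanned phi s p V.
Proof.
have atom s1 p1 op cs V1 (f : mso l c) : enc_mso f = op :: cs -> op < 4 ->
    size (enc_mso f) = (if op < 2 then 5 else 4) ->
    mso_len f = 3 -> num_svars f = 0 -> num_vvars f = 0 ->
    at_code (arr s1 1) p1 (enc_mso f) ->
    reg s1 rPos = p1 -> p1 + size (enc_mso f) <= arr s1 0 4 ->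
    reg s1 rT = reg s1 rD * V1 -> scanned f s1 p1 V1.
  move=> ef op4 hk l3 s0 v0 hc hp hl hT; rewrite ef in hc.
  exists 1, (stp (nth Skip scan_table op) s1); rewrite l3 s0 v0 muln1 addn0.
  split=> //; first by apply: scan_step hc hp _; move: hl; rewrite ef /=; lia.
  - by rewrite hk; case: op op4 {hk hc ef} => [|[|[|[]]]] // _; rewrite /= /upd /= hp.
  - by case: op op4 {hk hc ef} => [|[|[|[]]]].
  - by case: op op4 {hk hc ef} => [|[|[|[]]]].
have pass s1 p1 op cs b : at_code (arr s1 1) p1 (op :: cs) -> 3 < op < 9 ->
    reg s1 rPos = p1 -> p1 + (size cs).+1 <= arr s1 0 4 -> b = reg s1 rD ->
    exists2 s2, reach scan_cond scan_body 1 s1 s2 & [/\ reg s2 rPos = p1.+1,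
      reg s2 rD = b, reg s2 rT = reg s1 rT & at_code (arr s2 1) p1.+1 cs].
  move=> hc op9 hp hl ->; exists (stp (nth Skip scan_table op) s1).
    by apply: scan_step hc hp _; lia.
  have -> : nth Skip scan_table op = inc rPos 1.
    by move: op9 {hc}; do 9?case: op => [|op] //.
  by case: hc => _ hc; rewrite /= /upd /= hp addn1.
have op_range o : 3 < enc_conn o < 9 by case: o.
have vquant s1 p1 op x cs V1 : at_code (arr s1 1) p1 [:: op, x & cs] ->
    8 < op < 11 -> reg s1 rPos = p1 -> p1 + (size cs).+2 <= arr s1 0 4 ->
    reg s1 rT = reg s1 rD * V1 ->
    exists2 s2, reach scan_cond scan_body 1 s1 s2 & [/\ reg s2 rPos = p1.+2,
      reg s2 rD = reg s1 rD, reg s2 rT = reg s2 rD * V1.+1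
      & at_code (arr s2 1) p1.+2 cs].
  move=> hc op9 hp hl hT; exists (stp (nth Skip scan_table op) s1).
    by apply: scan_step hc hp _; lia.
  have -> : nth Skip scan_table op = nth Skip scan_table 9.
    by move: op9 {hc}; do 11?case: op => [|op] //.
  by case: hc => _ [_ hc]; rewrite /= /upd /= hp hT addn2 mulnS addnC.
have squant s1 p1 op x cs V1 : at_code (arr s1 1) p1 [:: op, x & cs] ->
    10 < op < 13 -> reg s1 rPos = p1 -> p1 + (size cs).+2 <= arr s1 0 4 ->
    reg s1 rT = reg s1 rD * V1 ->
    exists2 s2, reach scan_cond scan_body 1 s1 s2 & [/\ reg s2 rPos = p1.+2,
      reg s2 rD = reg s1 rD + reg s1 rD, reg s2 rT = reg s2 rD * V1
      & at_code (arr s2 1) p1.+2 cs].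
  move=> hc op9 hp hl hT; exists (stp (nth Skip scan_table op) s1).
    by apply: scan_step hc hp _; lia.
  have -> : nth Skip scan_table op = nth Skip scan_table 11.
    by move: op9 {hc}; do 13?case: op => [|op] //.
  by case: hc => _ [_ hc]; rewrite /= /upd /= hp hT addn2 mulnDl.
elim: phi s p V => [t u|t u|t i|t X|f IH|o f IHf g IHg|x f IH|x f IH|X f IH
  |X f IH] s p V hc hp hl hT.
- by apply: atom; rewrite //= size_cat !size_enc_term.
- by apply: atom; rewrite //= size_cat !size_enc_term.
- by apply: atom; rewrite //= size_rcons size_enc_term.
- by apply: atom; rewrite //= size_rcons size_enc_term.
- have [s2 r2 [p2 D2 T2 c2]] := pass _ _ _ _ _ hc isT hp hl erefl.
  have [||k [s3 [le3 r3 p3 D3 T3]]] := IH _ _ V c2 p2.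
  + by rewrite (reach_arr _ r2) //; move: hl => /=; lia.
  + by rewrite T2 hT D2.
  exists (1 + k), s3; split=> //=; first exact: reach_trans r2 r3.
    by rewrite p3; lia.
  by rewrite D3 D2.
- have [s2 r2 [p2 D2 T2 /at_code_cat [cf cg]]] :=
    pass _ _ _ _ _ hc (op_range o) hp hl erefl.
  move: hl => /=; rewrite size_cat => hl.
  have [||k [s3 [le3 r3 p3 D3 T3]]] := IHf _ _ V cf p2.
  + by rewrite (reach_arr _ r2) //; lia.
  + by rewrite T2 hT D2.
  have [|||k' [s4 [le4 r4 p4 D4 T4]]] := IHg s3 _ (V + num_vvars f) _ p3.
  + by rewrite (reach_arr _ r3).
  + by rewrite (reach_arr _ r3) // (reach_arr _ r2) //; lia.
  + exact: T3.
  exists (1 + (k + k')), s4; split=> //=.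
  + by lia.
  + exact: reach_trans r2 (reach_trans r3 r4).
  + by rewrite p4 size_cat; lia.
  + by rewrite D4 D3 D2 expnD mulnA.
  by rewrite T4 addnA.
- have [s2 r2 [p2 D2 T2 c2]] := vquant _ _ _ _ _ _ hc isT hp hl hT.
  have [|k [s3 [le3 r3 p3 D3 T3]]] := IH _ _ _ c2 p2 _ T2.
    by rewrite (reach_arr _ r2) //; move: hl => /=; lia.
  exists (1 + k), s3; split=> //=.
  + by lia.
  + exact: reach_trans r2 r3.
  + by rewrite p3; lia.
  + by rewrite D3 D2.
  by rewrite T3 addnS addSn.
- have [s2 r2 [p2 D2 T2 c2]] := vquant _ _ _ _ _ _ hc isT hp hl hT.
  have [|k [s3 [le3 r3 p3 D3 T3]]] := IH _ _ _ c2 p2 _ T2.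
    by rewrite (reach_arr _ r2) //; move: hl => /=; lia.
  exists (1 + k), s3; split=> //=.
  + by lia.
  + exact: reach_trans r2 r3.
  + by rewrite p3; lia.
  + by rewrite D3 D2.
  by rewrite T3 addnS addSn.
- have [s2 r2 [p2 D2 T2 c2]] := squant _ _ _ _ _ _ hc isT hp hl hT.
  have [|k [s3 [le3 r3 p3 D3 T3]]] := IH _ _ _ c2 p2 _ T2.
    by rewrite (reach_arr _ r2) //; move: hl => /=; lia.
  exists (1 + k), s3; split=> //=.
  + by lia.
  + exact: reach_trans r2 r3.
  + by rewrite p3; lia.
  by rewrite D3 D2 expnS mulnA muln2 addnn.
- have [s2 r2 [p2 D2 T2 c2]] := squant _ _ _ _ _ _ hc isT hp hl hT.
  have [|k [s3 [le3 r3 p3 D3 T3]]] := IH _ _ _ c2 p2 _ T2.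
    by rewrite (reach_arr _ r2) //; move: hl => /=; lia.
  exists (1 + k), s3; split=> //=.
  + by lia.
  + exact: reach_trans r2 r3.
  + by rewrite p3; lia.
  by rewrite D3 D2 expnS mulnA muln2 addnn.
Qed.

(** Both arrays are specified at every index, with 0 outside the kernel, so that untouched memory
    represents the empty kernel. *)
Definition ker_store (s : store) (K : seq nat) : Prop :=
  [/\ uniq K, reg s rM = size K, reg s rN = 2 ^ size K,
      arr s aKer =1 nth 0 K
    & arr s aIdx =1 fun v => if v \in K then (index v K).+1 else 0].

Lemma ker_store_eq s s' K : ker_store s K ->
  (forall x, x \in [:: rM; rN] -> reg s' x = reg s x) ->
  (forall a, a \in [:: aKer; aIdx] -> arr s' a = arr s a) -> ker_store s' K.
Proof. by move=> [u hM hN hK hI] er ea; split; rewrite ?er ?ea. Qed.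

Lemma ker_store_add s K : ker_store s K -> reg s rU \notin K ->
  ker_store (stp add_vertex s) (rcons K (reg s rU)).
Proof.
move=> [u hM hN hK hI] nU; split.
- by rewrite rcons_uniq nU.
- by rewrite /= /upd /= hM size_rcons addn1.
- by rewrite /= /upd /= hN size_rcons expnS mul2n addnn.
- move=> i; rewrite /= /upd /= hM nth_rcons hK.
  case: (ltngtP i (size K)) => // lt_i.
  by rewrite nth_default // ltnW.
move=> v; rewrite /= /upd /= hM addn1 -cats1 mem_cat inE index_cat hI /=.
case: (v =P reg s 6) => [->|/eqP ne] /=.
  by rewrite (negPf nU) eqxx addn0.
by rewrite orbF; case: ifP => // ->.
Qed.

Lemma ker_store_mem s K v : ker_store s K -> (arr s aIdx v == 0) = (v \notin K).
Proof. by case=> _ _ _ _ ->; case: ifP. Qed.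

Lemma stp_ifT e p q s : eval s e != 0 -> stp (If e p q) s = stp p s.
Proof. by move=> /negPf /= ->. Qed.

(** K agrees with the labels only as a set, since several labels may name one vertex. *)
Lemma run_labels labs r : forall s K i, i + r = size labs ->
  arr s 2 =1 nth 0 labs -> arr s 0 1 = size labs -> reg s rI = i ->
  ker_store s K -> K =i take i labs -> size K <= i ->
  exists s' K', [/\ reach label_cond label_body r s s', eval s' label_cond = 0,
    ker_store s' K', K' =i labs & size K' <= size labs].
Proof.
elim: r => [|r IH] s K i ir h2 h0 hi hK eK leK.
  rewrite addn0 in ir; rewrite {}ir in hi eK leK.
  exists s, K; split=> //; first exact: Reach0.
    by rewrite /= h0 hi subnn.
  by rewrite take_size in eK.
have e0 : eval s label_cond != 0 by rewrite /= h0 hi; lia.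
set v := nth 0 labs i.
have [s1 [K1 [Es hi1 hK1 eK1 leK1]]] : exists s1 K1,
    [/\ stp label_body s = s1, reg s1 rI = i.+1, ker_store s1 K1,
        K1 =i take i.+1 labs & size K1 <= i.+1].
  have eT : take i.+1 labs =i v :: take i labs.
    by move=> x; rewrite (take_nth 0) ?mem_rcons //; lia.
  pose s0 := Store (upd (upd (reg s) rU v) rI (i + 1)) (arr s).
  have hK0 : ker_store s0 K by apply: ker_store_eq hK _ _ => // x;
    rewrite !inE => /orP [] /eqP ->.
  have Es : stp label_body s = if v \in K then s0 else stp add_vertex s0.
    rewrite /label_body /=.
    have -> : arr s 2 (reg s 10) = v by rewrite h2 hi.
    rewrite /upd /= (ker_store_mem _ hK) hi.
    by rewrite /s0 /upd; case: (v \in K).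
  rewrite Es; case: ifP => [vK|/negbT vK].
    exists s0, K; split=> //; [by rewrite /= addn1| |exact: leqW].
    by move=> x; rewrite eT inE eK; case: eqP => // ->; rewrite -eK vK.
  exists (stp add_vertex s0), (rcons K v); split=> //.
  - by rewrite /= /upd /= addn1.
  - exact: ker_store_add.
  - by move=> x; rewrite eT mem_rcons !inE eK.
  - by rewrite size_rcons.
have [|||s' [K' [r' e' h1 h3 h4]]] := IH s1 K1 i.+1 _ _ _ hi1 hK1 eK1 leK1.
- by lia.
- by rewrite -Es stp_arr.
- by rewrite -Es stp_arr.
exists s', K'; split=> //.
by rewrite -[r.+1]add1n; apply: reach_trans r'; rewrite -Es; apply: reach1.
Qed.

Definition kern_step (T : eqType) (t : nat) (K B : seq T) : seq T :=
  K ++ take t [seq v <- B | v \notin K].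

Definition kern (T : eqType) (t : nat) : seq T -> seq (seq T) -> seq T :=
  foldl (kern_step t).

Lemma kern_size (T : eqType) t (K : seq T) Bs : size K <= size (kern t K Bs).
Proof.
elim: Bs K => //= B Bs IH K; apply: leq_trans (IH _).
by rewrite size_cat leq_addr.
Qed.

Lemma kern_size_le (T : eqType) t (K : seq T) Bs :
  size (kern t K Bs) <= size K + size Bs * t.
Proof.
elim: Bs K => [|B Bs IH] K /=; first by rewrite addn0.
apply: leq_trans (IH _) _; rewrite size_cat mulSn addnA leq_add2r leq_add2l.
by rewrite size_take_min geq_minl.
Qed.

(** Each iteration either uses up one of the [cnt] new vertices or meets a vertex of K. This keeps
    the time independent of the size of the block. *)
Lemma run_block B : forall s K j cnt, ker_store s K -> uniq B ->
  at_code (arr s 7) j B -> reg s rJ = j -> reg s rE = j + size B ->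
  reg s rC = cnt ->
  exists k s', [/\ k <= cnt + count (mem K) B,
    reach block_cond block_body k s s', reg s' rI = reg s rI,
    eval s' in_block = 0
    & ker_store s' (K ++ take cnt [seq v <- B | v \notin K])].
Proof.
elim: B => [|v B IH] s K j cnt hK uB hB hJ hE hC.
  exists 0, s; split=> //; first exact: Reach0.
    by rewrite /= hJ hE hC addn0 subnn subn0 subnn.
  by rewrite cats0.
case: cnt hC => [|cnt] hC.
  exists 0, s; split=> //; first exact: Reach0.
    by rewrite /= hC.
  by rewrite take0 cats0.
have ein : eval s in_block != 0 by move: hE; rewrite /= hC hJ => ->; lia.
have e0 : eval s block_cond != 0.
  have -> : eval s block_cond = arr s 0 3 - reg s rI + eval s in_block by [].
  by rewrite addn_eq0 negb_and ein orbT.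
case: hB => hv hB; case/andP: uB => vB uB.
pose s0 := Store (upd (upd (reg s) rU v) rJ (j + 1)) (arr s).
have hK0 : ker_store s0 K by apply: ker_store_eq hK _ _ => // x;
  rewrite !inE => /orP [] /eqP ->.
have Es : stp block_body s = if v \in K then s0 else
    stp (Assign rC (Sub (Reg rC) (Const 1))) (stp add_vertex s0).
  rewrite /block_body (stp_ifT _ _ ein) /= hJ hv.
  rewrite /upd /= (ker_store_mem _ hK) hJ hC.
  by rewrite /s0 /upd; case: (v \in K).
have r1 : reach block_cond block_body 1 s (stp block_body s) by apply: reach1.
have hB1 : at_code (arr (stp block_body s) 7) j.+1 B by rewrite stp_arr.
have hE1 : reg (stp block_body s) rE = j.+1 + size B.
  by rewrite Es; case: ifP => _; rewrite /= /upd /= hE addSnnS.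
have hJ1 : reg (stp block_body s) rJ = j.+1.
  by rewrite Es; case: ifP => _; rewrite /= /upd /= addn1.
have hI1 : reg (stp block_body s) rI = reg s rI.
  by rewrite Es; case: ifP.
rewrite [X in _ ++ take _ X]/=; case: ifP Es => [vK|/negbT vK] Es.
  have [||k [s' [lek r' hI' hin hK']]] :=
    IH (stp block_body s) K j.+1 cnt.+1 _ uB hB1 hJ1 hE1.
  - by rewrite Es.
  - by rewrite Es.
  exists (1 + k), s'; split=> //.
  - by rewrite [count _ _]/= vK addnCA leq_add2l.
  - exact: reach_trans r1 r'.
  - by rewrite hI' hI1.
have eqF : [seq x <- B | x \notin rcons K v] = [seq x <- B | x \notin K].
  apply: eq_in_filter => x xB; rewrite mem_rcons inE negb_or.
  by case: eqP => // xv; rewrite -xv xB in vB.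
have [||k [s' [lek r' hI' hin hK']]] :=
    IH (stp block_body s) (rcons K v) j.+1 cnt _ uB hB1 hJ1 hE1.
- rewrite Es; apply: ker_store_eq (ker_store_add hK0 _) _ _ => //.
  by move=> x; rewrite !inE => /orP [] /eqP ->.
- by rewrite Es /= /upd /= hC subn1.
exists (1 + k), s'; split=> //.
- have eqC : count (mem (rcons K v)) B = count (mem K) B.
    apply: eq_in_count => x xB /=; rewrite mem_rcons inE.
    by case: eqP => // xv; rewrite -xv xB in vB.
  by rewrite [count _ _]/= (negPf vK) -eqC !add0n add1n ltnS.
- exact: reach_trans r1 r'.
- by rewrite hI' hI1.
by move: hK'; rewrite eqF cat_rcons.
Qed.

Fixpoint layout (A7 A8 : nat -> nat) (i j : nat) (Bs : seq (seq nat)) : Prop :=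
  if Bs is B :: Bs' then
    [/\ A8 i = j, A8 i.+1 = j + size B, at_code A7 j B
      & layout A7 A8 i.+1 (j + size B) Bs']
  else True.

(** Per block: one iteration to open it, at most t for new vertices, and at most b for known ones,
    since these are distinct members of the final kernel. *)
Lemma run_blocks t b Bs : forall s K i j, ker_store s K ->
  layout (arr s 7) (arr s 8) i j Bs -> all uniq Bs -> reg s rI = i ->
  i + size Bs = arr s 0 3 -> eval s in_block = 0 -> reg s rT = t ->
  size (kern t K Bs) <= b ->
  exists k s', [/\ k <= size Bs * (t + b).+1,
    reach block_cond block_body k s s', eval s' block_cond = 0
    & ker_store s' (kern t K Bs)].
Proof.
elim: Bs => [|B Bs IH] s K i j hK hL uBs hI hi hin hT hb.
  exists 0, s; split=> //; first exact: Reach0.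
  by move: hin; rewrite /= hI -hi addn0 subnn.
case: hL => h8 h8' h7 hL; case/andP: uBs => uB uBs.
have e0 : eval s block_cond != 0 by move: hi; rewrite /= hI => <-; lia.
have Es : stp block_body s = Store (upd (upd (upd (upd (reg s)
    rJ j) rI (i + 1)) rE (j + size B)) rC t) (arr s).
  rewrite /block_body /= -/(eval s in_block).
  have := hin; rewrite /= => ->.
  by rewrite /= /upd /= hI h8 addn1 h8' hT.
have r1 : reach block_cond block_body 1 s (stp block_body s) by apply: reach1.
have [|||||k [s2 [lek r2 hI2 hin2 hK2]]] :=
  @run_block B (stp block_body s) K j t _ uB.
- rewrite Es; apply: ker_store_eq hK _ _ => // x.
  by rewrite !inE => /orP [] /eqP ->.
- by rewrite Es.
- by rewrite Es.
- by rewrite Es.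
- by rewrite Es.
have A2 a : a \notin warrs block_body -> arr s2 a = arr s a.
  by move=> na; rewrite (reach_arr na r2) stp_arr.
have [|||||k' [s3 [lek' r3 e3 hK3]]] :=
  IH s2 _ i.+1 (j + size B) hK2 _ uBs _ _ hin2.
- by rewrite !A2.
- by rewrite hI2 Es /= /upd /= addn1.
- by rewrite A2 // addSnnS.
- by rewrite (reach_reg _ r2) // stp_reg.
- exact: hb.
exists (1 + (k + k')), s3; split=> //.
  have : count (mem K) B <= b.
    apply: leq_trans hb; apply: leq_trans (kern_size t K (B :: Bs)).
    rewrite -size_filter; apply: uniq_leq_size; first exact: filter_uniq.
    by move=> x; rewrite mem_filter => /andP [].
  move=> hc; rewrite [size _]/= mulSn addnA add1n leq_add // ltnS.
  by apply: leq_trans lek _; rewrite leq_add2l.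
exact: reach_trans r1 (reach_trans r2 r3).
Qed.

Lemma run_half r : forall s i, i + r = reg s rN -> reg s rI = i ->
  (forall x, x < i.*2 -> arr s aHalf x = x./2) ->
  exists s', [/\ reach half_cond half_body r s s', eval s' half_cond = 0
    & forall x, x < (reg s rN).*2 -> arr s' aHalf x = x./2].
Proof.
elim: r => [|r IH] s i ir hi h.
  exists s; split=> //; first exact: Reach0.
    by rewrite /= hi -ir addn0 subnn.
  by rewrite -ir addn0.
have e0 : eval s half_cond != 0 by rewrite /= hi; lia.
have [|||s' [r' e' h']] := IH (stp half_body s) i.+1.
- by rewrite stp_reg // addSnnS.
- by rewrite /= /upd /= hi addn1.
- move=> x ltx; rewrite /= /upd /= hi !addn1.
  case: eqP => [->|ne1]; first by lia.
  case: eqP => [->|ne2]; first by lia.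
  by apply: h; lia.
exists s'; split=> //.
by rewrite -[r.+1]add1n; apply: reach_trans r'; apply: reach1.
Qed.

(** * Counting up to a threshold *)

Definition near (t a b : nat) : Prop := minn a t = minn b t.

Lemma near_pred t a b : near t.+1 a.+1 b.+1 -> near t a b.
Proof. by rewrite /near; lia. Qed.

Lemma near_le t t' a b : t' <= t -> near t a b -> near t' a b.
Proof. by rewrite /near; lia. Qed.

(* When a cell is split into parts of sizes a1 and a2, the matching cell of size
   b is split into parts of sizes share h a1 a2 b and the rest. *)
Definition share (h a1 a2 b : nat) : nat :=
  if a1 < h then a1 else if a2 < h then b - a2 else h.

(** A part smaller than h is copied exactly; the other part then either also matches exactly or has
    at least h elements on both sides. If both parts have at least h elements, their union has at
    least 2h, hence so does the matching cell, as [h.*2 <= t], and h elements can go to each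
    side. *)
Lemma shareP t h a1 a2 b : near t (a1 + a2) b -> h.*2 <= t ->
  [/\ share h a1 a2 b <= b, near h a1 (share h a1 a2 b)
    & near h a2 (b - share h a1 a2 b)].
Proof.
rewrite /near /share => nt ht.
by case: (ltnP a1 h) => h1; last case: (ltnP a2 h) => h2; split; lia.
Qed.

(** A canonical subset of prescribed size, so that one comprehension can choose the parts of all
    cells at once. *)
Lemma card_prefix (T : finType) (C : {set T}) b : b <= #|C| ->
  #|[set x in C | index x (enum C) < b]| = b.
Proof.
move=> leb.
have -> : [set x in C | index x (enum C) < b] = [set x in take b (enum C)].
  apply/setP => x; rewrite !inE; case xC: (x \in C) => /=.
    by rewrite in_take // mem_enum.
  by apply/esym/negP => /mem_take; rewrite mem_enum xC.
rewrite cardsE (card_uniqP _) ?take_uniq ?enum_uniq // size_takel //.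
by rewrite -cardE.
Qed.

Section Cells.
Variables (T1 T2 : finType).

(* chi colours the elements by everything known about them so far; a cell
   consists of the elements of a given colour that carry no name. *)
Definition cell (T : finType) (N : seq T) (chi : T -> seq nat) (k : seq nat) :
    {set T} :=
  [set u | (u \notin N) && (chi u == k)].

(** The invariant of the game. Named elements are matched individually and leave their cells, so the
    threshold concerns only what remains. *)
Record similar (t : nat) (N : seq (T1 * T2)) (chi1 : T1 -> seq nat)
    (chi2 : T2 -> seq nat) : Prop := Similar {
  sim_inj : {in N &, forall p q, (p.1 == q.1) = (p.2 == q.2)};
  sim_col : {in N, forall p, chi1 p.1 = chi2 p.2};
  sim_near : forall k,
    near t #|cell (unzip1 N) chi1 k| #|cell (unzip2 N) chi2 k|
}.

(** A named vertex is answered by its partner. An unnamed one lies in a nonempty cell; the threshold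
    being positive, the matching cell is nonempty too, and removing one vertex from each costs one
    unit of threshold. *)
Lemma similar_vertex t N chi1 chi2 u : similar t.+1 N chi1 chi2 ->
  exists u', similar t ((u, u') :: N) chi1 chi2.
Proof.
move=> [inj col nr]; case uN: (u \in unzip1 N).
  have /mapP [[u1 u'] uu' /= eu] := uN; exists u'; rewrite -{u1}eu in uu'.
  have add (T : finType) (x : T) r chi k :
      x \in r -> cell (x :: r) chi k = cell r chi k.
    move=> xr; apply/setP => y; rewrite !inE negb_or.
    by case: eqP => // ->; rewrite xr.
  split.
  - move=> p q; rewrite !inE => /predU1P [->|pN] /predU1P [->|qN];
    exact: inj.
  - by move=> p; rewrite inE => /predU1P [->|]; apply: col.
  move=> k; rewrite /= !add //; first by apply: near_le (nr k).
  by apply/mapP; exists (u, u').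
have uC : u \in cell (unzip1 N) chi1 (chi1 u) by rewrite inE uN eqxx.
have [u' u'C] : exists u', u' \in cell (unzip2 N) chi2 (chi1 u).
  apply/set0Pn; rewrite -card_gt0.
  have := nr (chi1 u); rewrite (cardsD1 u) uC /near; lia.
have [u'N cu] : u' \notin unzip2 N /\ chi2 u' = chi1 u.
  by move: u'C; rewrite inE => /andP [? /eqP].
exists u'; have ne p : p \in N -> (u == p.1) = (u' == p.2).
  move=> pN; have /negPf -> : u != p.1.
    by apply: contraFneq uN => ->; apply: map_f.
  by apply/esym/negP => /eqP e; rewrite e map_f in u'N.
split.
- move=> p q; rewrite !inE => /predU1P [->|pN] /predU1P [->|qN] /=.
  + by rewrite !eqxx.
  + exact: ne.
  + by rewrite ![_.1 == _]eq_sym ![_.2 == _]eq_sym; apply: ne.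
  exact: inj.
- by move=> p; rewrite inE => /predU1P [->|] //; apply: col.
move=> k; have del (T : finType) (x : T) r chi :
    cell (x :: r) chi k = cell r chi k :\ x.
  by apply/setP => y; rewrite !inE negb_or andbA.
rewrite /= !del; have := nr k.
rewrite (cardsD1 u) (cardsD1 u' (cell _ _ _)) !inE uN u'N cu /=.
case: eqP => _ /=; first exact: near_pred.
exact: near_le.
Qed.

Definition refine (T : finType) (chi : T -> seq nat) (B : {set T}) (u : T) :
    seq nat :=
  nat_of_bool (u \in B) :: chi u.

(** The set splits every cell in two, and [shareP] answers each split separately. *)
Lemma similar_set t h N chi1 chi2 (B : {set T1}) : similar t N chi1 chi2 ->
  h.*2 <= t ->
  exists B' : {set T2}, similar h N (refine chi1 B) (refine chi2 B').
Proof.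
move=> [inj col nr] ht.
pose C1 k := cell (unzip1 N) chi1 k; pose C2 k := cell (unzip2 N) chi2 k.
pose b k := share h #|C1 k :&: B| #|C1 k :\: B| #|C2 k|.
have bP k : [/\ b k <= #|C2 k|, near h #|C1 k :&: B| (b k)
    & near h #|C1 k :\: B| (#|C2 k| - b k)].
  by apply: (@shareP t); rewrite // cardsID; apply: nr.
(* Named elements copy the membership of their partner, which is unambiguous by [inj]; the others
   enter as a prefix of their cell, of the size given by [share]. *)
pose B' := [set u | if u \in unzip2 N
                    then has (fun p => (p.2 == u) && (p.1 \in B)) N
                    else index u (enum (C2 (chi2 u))) < b (chi2 u)].
have C2B k : #|C2 k :&: B'| = b k.
  rewrite -[RHS](@card_prefix _ (C2 k)); last by case: (bP k).
  apply: eq_card => u; rewrite !inE; case: (u \in unzip2 N) => //=.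
  by case: eqP => // ->.
exists B'; split=> //.
- move=> p pN; rewrite /refine (col p pN); congr (nat_of_bool _ :: _).
  rewrite inE map_f //; apply/idP/hasP => [pB|[q qN /andP [/eqP eq qB]]].
    by exists p; rewrite ?eqxx.
  by have := inj p q pN qN; rewrite eq eqxx => /eqP ->.
(* A refined colour is never the empty list, so that cell is empty on both sides. *)
case=> [|x k].
  by rewrite /near !eq_card0 // => u; rewrite !inE andbF.
have refE (T : finType) (D : {set T}) r chi : cell r (refine chi D) (x :: k) =
    if x == 1 then cell r chi k :&: D
    else if x == 0 then cell r chi k :\: D else set0.
  apply/setP => u; rewrite !inE /refine eqseq_cons.
  by case: x => [|[|x]]; rewrite ?inE; case: (u \in D); rewrite /= ?andbT ?andbF.
rewrite !refE; case: ifP => _; first by rewrite C2B; case: (bP k).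
case: ifP => _; last by rewrite !cards0.
by rewrite (cardsD (cell (unzip2 N) _ _)) C2B; case: (bP k).
Qed.

End Cells.

(** Exchanging the two structures turns the back moves of the game into forth moves. *)
Definition swap_pair {T1 T2 : Type} (p : T1 * T2) : T2 * T1 := (p.2, p.1).

Lemma similar_sym (T1 T2 : finType) t (N : seq (T1 * T2)) chi1 chi2 :
  similar t N chi1 chi2 -> similar t (map swap_pair N) chi2 chi1.
Proof.
have u1 : unzip1 (map swap_pair N) = unzip2 N by rewrite /unzip1 -map_comp.
have u2 : unzip2 (map swap_pair N) = unzip1 N by rewrite /unzip2 -map_comp.
move=> [inj col nr]; split.
- by move=> p q /mapP [p' pN ->] /mapP [q' qN ->] /=; rewrite inj.
- by move=> p /mapP [p' pN ->] /=; rewrite col.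
by move=> k; rewrite u1 u2; apply/esym/nr.
Qed.

Section Quantifiers.
Variables (T1 T2 : finType) (g1 : T1 -> bool) (g2 : T2 -> bool).
Hypothesis forth : forall u, exists u', g1 u = g2 u'.
Hypothesis back : forall u', exists u, g1 u = g2 u'.

Lemma exists_transfer : [exists u, g1 u] = [exists u, g2 u].
Proof.
apply/existsP/existsP => [[u gu]|[u gu]].
  by have [u' e] := forth u; exists u'; rewrite -e.
by have [u' e] := back u; exists u'; rewrite e.
Qed.

Lemma forall_transfer : [forall u, g1 u] = [forall u, g2 u].
Proof.
apply/forallP/forallP => g u.
  by have [u' <-] := back u.
by have [u' ->] := forth u.
Qed.

End Quantifiers.

(** * The Ehrenfeucht-Fraisse game *)

Section Game.
Variables (l c : nat).

(** [pos_adj] compares equality patterns because colours alone do not fix adjacency: in a block that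
    is a clique, distinct vertices are adjacent but no vertex is adjacent to itself. It speaks of
    all vertices, not only named ones, so that it survives every move. *)
Record game_pos n1 n2 (G1 : lcgraph n1 l c) (G2 : lcgraph n2 l c) (vs ss : seq nat)
    (ev1 : nat -> option 'I_n1) (es1 : nat -> {set 'I_n1})
    (ev2 : nat -> option 'I_n2) (es2 : nat -> {set 'I_n2})
    (N : seq ('I_n1 * 'I_n2)) (chi1 : 'I_n1 -> seq nat)
    (chi2 : 'I_n2 -> seq nat) : Prop := GamePos {
  pos_adj : forall u u' v v', chi1 u = chi2 u' -> chi1 v = chi2 v' ->
    (u == v) = (u' == v') -> adj G1 u v = adj G2 u' v';
  pos_col : forall u u' i,
    chi1 u = chi2 u' -> (u \in col G1 i) = (u' \in col G2 i);
  pos_lab : forall i, (lab G1 i, lab G2 i) \in N;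
  pos_var : {in vs, forall x, exists2 p, p \in N
    & ev1 x = Some p.1 /\ ev2 x = Some p.2};
  pos_set : {in ss, forall X u u',
    chi1 u = chi2 u' -> (u \in es1 X) = (u' \in es2 X)}
}.

Lemma game_sym n1 n2 G1 G2 vs ss ev1 es1 ev2 es2 N chi1 chi2 :
  @game_pos n1 n2 G1 G2 vs ss ev1 es1 ev2 es2 N chi1 chi2 ->
  @game_pos n2 n1 G2 G1 vs ss ev2 es2 ev1 es1 (map swap_pair N) chi2 chi1.
Proof.
move=> [ha hc hl hv hs]; split.
- by move=> u u' v v' eu ev e; apply/esym/ha.
- by move=> u u' i e; apply/esym/hc.
- by move=> i; rewrite (map_f swap_pair (hl i)).
- by move=> x /hv [p pN [e1 e2]]; exists (swap_pair p); first exact: map_f.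
by move=> X XS u u' e; apply/esym/hs.
Qed.

Lemma game_vertex n1 n2 G1 G2 vs ss ev1 es1 ev2 es2 N chi1 chi2 x u u' :
  @game_pos n1 n2 G1 G2 vs ss ev1 es1 ev2 es2 N chi1 chi2 ->
  game_pos G1 G2 (x :: vs) ss (upd ev1 x (Some u)) es1 (upd ev2 x (Some u')) es2
    ((u, u') :: N) chi1 chi2.
Proof.
move=> [ha hc hl hv hs]; split=> //.
  by move=> i; rewrite inE hl orbT.
move=> y; rewrite inE /upd; case: eqP => [_ _|_ /= /hv [p pN e]].
  by exists (u, u'); rewrite ?inE ?eqxx.
by exists p; rewrite // inE pN orbT.
Qed.

Lemma game_set n1 n2 G1 G2 vs ss ev1 es1 ev2 es2 N chi1 chi2 X B B' :
  @game_pos n1 n2 G1 G2 vs ss ev1 es1 ev2 es2 N chi1 chi2 ->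
  game_pos G1 G2 vs (X :: ss) ev1 (upd es1 X B) ev2 (upd es2 X B')
    N (refine chi1 B) (refine chi2 B').
Proof.
move=> [ha hc hl hv hs]; split=> //.
- by move=> u u' v v' [_ eu] [_ ev]; apply: ha.
- by move=> u u' i [_ e]; apply: hc.
move=> Y; rewrite inE /upd; case: eqP => [_ _|_ /= YS] u u' [eB e].
  by case: (u \in B) (u' \in B') eB => [] [].
exact: hs.
Qed.

Lemma game_term n1 n2 G1 G2 vs ss ev1 es1 ev2 es2 N chi1 chi2 (t : term l) :
  @game_pos n1 n2 G1 G2 vs ss ev1 es1 ev2 es2 N chi1 chi2 -> term_scoped vs t ->
  exists2 p, p \in N
    & term_val G1 ev1 t = Some p.1 /\ term_val G2 ev2 t = Some p.2.
Proof.
move=> [ha hc hl hv hs]; case: t => [x|i] /= h; first exact: hv.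
by exists (lab G1 i, lab G2 i).
Qed.

(* Cells with at least this many elements look alike to phi. *)
Definition need (phi : mso l c) : nat := 2 ^ num_svars phi * num_vvars phi.

Lemma need_bin o f g : need f <= need (Bin o f g) /\ need g <= need (Bin o f g).
Proof.
by split; rewrite /need /= leq_mul ?leq_pexp2l ?leq_addr ?leq_addl.
Qed.

(** [need] grows by at least one at a vertex quantifier and doubles at a set quantifier, which is
    what the two kinds of move cost. Both graphs are quantified after [phi], so the induction
    hypothesis also applies with them exchanged. *)
Theorem game (phi : mso l c) :
  forall n1 n2 G1 G2 vs ss ev1 es1 ev2 es2 N chi1 chi2 t,
  @game_pos n1 n2 G1 G2 vs ss ev1 es1 ev2 es2 N chi1 chi2 ->
  similar t N chi1 chi2 -> scoped vs ss phi -> need phi <= t ->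
  sat G1 ev1 es1 phi = sat G2 ev2 es2 phi.
Proof.
have vertex_move f x n1 n2 G1 G2 vs ss ev1 es1 ev2 es2 N chi1 chi2 t :
    (forall n1 n2 G1 G2 vs ss ev1 es1 ev2 es2 N chi1 chi2 t,
      @game_pos n1 n2 G1 G2 vs ss ev1 es1 ev2 es2 N chi1 chi2 ->
      similar t N chi1 chi2 -> scoped vs ss f -> need f <= t ->
      sat G1 ev1 es1 f = sat G2 ev2 es2 f) ->
    @game_pos n1 n2 G1 G2 vs ss ev1 es1 ev2 es2 N chi1 chi2 ->
    similar t N chi1 chi2 -> scoped (x :: vs) ss f -> need (ExV x f) <= t ->
    forall u, exists u',
      sat G1 (upd ev1 x (Some u)) es1 f = sat G2 (upd ev2 x (Some u')) es2 f.
  move=> IH pos sim sc; rewrite /need /= mulnS => le_t u.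
  have p2 : 0 < 2 ^ num_svars f by rewrite expn_gt0.
  case: t sim le_t => [|t] sim le_t; first by lia.
  have [u' sim'] := similar_vertex u sim.
  exists u'; apply: IH (game_vertex x u u' pos) sim' sc _.
  by rewrite /need; lia.
have set_move f X n1 n2 G1 G2 vs ss ev1 es1 ev2 es2 N chi1 chi2 t :
    (forall n1 n2 G1 G2 vs ss ev1 es1 ev2 es2 N chi1 chi2 t,
      @game_pos n1 n2 G1 G2 vs ss ev1 es1 ev2 es2 N chi1 chi2 ->
      similar t N chi1 chi2 -> scoped vs ss f -> need f <= t ->
      sat G1 ev1 es1 f = sat G2 ev2 es2 f) ->
    @game_pos n1 n2 G1 G2 vs ss ev1 es1 ev2 es2 N chi1 chi2 ->
    similar t N chi1 chi2 -> scoped vs (X :: ss) f -> need (ExS X f) <= t ->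
    forall B, exists B',
      sat G1 ev1 (upd es1 X B) f = sat G2 ev2 (upd es2 X B') f.
  move=> IH pos sim sc; rewrite /need /= expnS -mulnA mul2n => le_t B.
  have [B' sim'] := similar_set B sim le_t.
  by exists B'; apply: IH (game_set X B B' pos) sim' sc (leqnn _).
elim: phi => [t1 t2|t1 t2|t1 i|t1 X|f IH|o f IHf g IHg|x f IH|x f IH|X f IH
  |X f IH]
  n1 n2 G1 G2 vs ss ev1 es1 ev2 es2 N chi1 chi2 t pos sim.
- case/andP=> s1 s2 _ /=.
  have [p pN [-> ->]] := game_term pos s1.
  have [q qN [-> ->]] := game_term pos s2.
  by apply: (pos_adj pos); rewrite ?(sim_col sim) ?(sim_inj sim).
- case/andP=> s1 s2 _ /=.
  have [p pN [-> ->]] := game_term pos s1.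
  have [q qN [-> ->]] := game_term pos s2.
  exact: (sim_inj sim).
- move=> s1 _ /=; have [p pN [-> ->]] := game_term pos s1.
  by apply: (pos_col pos); rewrite (sim_col sim).
- case/andP=> s1 XS _ /=; have [p pN [-> ->]] := game_term pos s1.
  by apply: (pos_set pos); rewrite ?(sim_col sim).
- by move=> sc le_t /=; congr (~~ _); apply: IH pos sim sc le_t.
- case/andP=> sf sg le_t /=; have [nf ng] := need_bin o f g.
  rewrite (IHf _ _ _ _ _ _ _ _ _ _ _ _ _ _ pos sim sf (leq_trans nf le_t)).
  by rewrite (IHg _ _ _ _ _ _ _ _ _ _ _ _ _ _ pos sim sg (leq_trans ng le_t)).
- move=> sc le_t; apply: exists_transfer.
    exact: vertex_move IH pos sim sc le_t.
  move=> u'; have [u e] := vertex_move _ _ _ _ _ _ _ _ _ _ _ _ _ _ _ _ IH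
    (game_sym pos) (similar_sym sim) sc le_t u'.
  by exists u; apply/esym.
- move=> sc le_t; apply: forall_transfer.
    exact: vertex_move IH pos sim sc le_t.
  move=> u'; have [u e] := vertex_move _ _ _ _ _ _ _ _ _ _ _ _ _ _ _ _ IH
    (game_sym pos) (similar_sym sim) sc le_t u'.
  by exists u; apply/esym.
- move=> sc le_t; apply: exists_transfer.
    exact: set_move IH pos sim sc le_t.
  move=> B'; have [B e] := set_move _ _ _ _ _ _ _ _ _ _ _ _ _ _ _ _ IH
    (game_sym pos) (similar_sym sim) sc le_t B'.
  by exists B; apply/esym.
- move=> sc le_t; apply: forall_transfer.
    exact: set_move IH pos sim sc le_t.
  move=> B'; have [B e] := set_move _ _ _ _ _ _ _ _ _ _ _ _ _ _ _ _ IH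
    (game_sym pos) (similar_sym sim) sc le_t B'.
  by exists B; apply/esym.
Qed.

End Game.

(** * The kernel has the same theory *)

Section Blocks.
Variable T : eqType.
Implicit Types (K B : seq T) (Bs : seq (seq T)).

(** [kern] filters each block by the kernel grown so far. As blocks are disjoint, what earlier
    blocks contributed does not occur in later ones, and the filter only removes members of the
    initial K. *)
Lemma mem_kern t K Bs v : uniq (flatten Bs) ->
  (v \in kern t K Bs) =
  (v \in K) || has (fun B => v \in take t [seq x <- B | x \notin K]) Bs.
Proof.
elim: Bs K => [|B Bs IH] K /=; first by rewrite orbF.
rewrite cat_uniq => /and3P [uB dis uBs]; rewrite IH // /kern_step mem_cat -orbA.
congr (_ || (_ || _)); apply: eq_in_has => B' B'Bs; congr (_ \in take _ _).
apply: eq_in_filter => x xB'; rewrite mem_cat negb_or.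
have xB : x \notin B.
  apply: (hasPn dis); apply/flattenP; by exists B'.
rewrite [X in _ && X](_ : _ = true) ?andbT //.
by apply: contra xB => /mem_take; rewrite mem_filter => /andP [].
Qed.

Lemma all_uniq_flatten Bs : uniq (flatten Bs) -> all uniq Bs.
Proof.
elim: Bs => //= B Bs IH; rewrite cat_uniq => /and3P [-> _ /IH] //.
Qed.

Definition block_index Bs (v : T) : nat := find (fun B => v \in B) Bs.

Lemma block_indexE Bs v b : uniq (flatten Bs) ->
  v \in flatten Bs -> (v \in nth [::] Bs b) = (block_index Bs v == b).
Proof.
rewrite /block_index => uBs vBs; apply/idP/eqP => [|<-]; last first.
  apply: (@nth_find _ [::] (fun B => v \in B)).
  by apply/hasP; have /flattenP [B BBs vB] := vBs; exists B.
elim: Bs b uBs {vBs} => [|B Bs IH] b; first by rewrite nth_nil.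
rewrite /= cat_uniq => /and3P [uB dis uBs].
case: b => [|b] /= vb; first by rewrite vb.
case: ifP => vB; last by rewrite (IH b).
have vF : v \in flatten Bs.
  apply/flattenP; exists (nth [::] Bs b) => //; apply: mem_nth.
  by rewrite ltnNge; apply/negP => /(nth_default [::]) e; rewrite e in vb.
by move/hasPn/(_ v vF): dis; rewrite /= vB.
Qed.

End Blocks.

(** The endpoints are replaced one at a time, which is sound as long as the new endpoint differs
    from the other end. If [v = u'], v has to be replaced first; if also [v' = u], the two edges are
    the same and symmetry suffices. *)
Lemma same_type_adj n l c (G : lcgraph n l c) u u' v v' :
  same_type G u u' -> same_type G v v' -> (u == v) = (u' == v') ->
  adj G u v = adj G u' v'.
Proof.
have tw x x' y : same_type G x x' -> y != x -> y != x' -> adj G x y = adj G x' y.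
  by move=> [_ /setP /(_ y)]; rewrite !inE => e h1 h2;
    move: e; rewrite h1 h2.
move=> uu' vv'; case: (eqVneq u v) => [-> /esym/eqP <-|uv /esym/negbT u'v'].
  by rewrite !adj_irr.
case: (eqVneq v u') => [vu'|vu']; last first.
  rewrite (tw _ _ _ uu' _ vu') 1?eq_sym // adj_sym.
  rewrite (tw _ _ _ vv') 1?(eq_sym u') //; last by rewrite eq_sym.
  by rewrite adj_sym.
case: (eqVneq v' u) => [->|v'u]; first by rewrite -vu' adj_sym.
rewrite adj_sym (tw _ _ _ vv' uv) 1?eq_sym // adj_sym.
by rewrite (tw _ _ _ uu' v'u) // eq_sym.
Qed.

Section Kernel.
Variables (n l c : nat) (G : lcgraph n l c) (K : seq 'I_n).
Hypothesis lab_in : forall i, lab G i \in K.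
Hypothesis uK : uniq K.

(** Kernel vertices are positions in K, exactly the numbers that [tval] yields; array 10 realises
    [ker_vertex]. *)
Definition ker_vertex (j : 'I_(size K)) : 'I_n := tnth (in_tuple K) j.

Lemma ker_vertex_inj : injective ker_vertex.
Proof.
move=> j j' /eqP; rewrite /ker_vertex !(tnth_nth (ker_vertex j)) /=.
by rewrite nth_uniq // => /eqP /val_inj.
Qed.

Lemma ker_vertexP v : v \in K -> exists j, ker_vertex j = v.
Proof.
move=> vK; have lt : index v K < size K by rewrite index_mem.
by exists (Ordinal lt); rewrite /ker_vertex (tnth_nth v) /= nth_index.
Qed.

Lemma lab_index_lt i : index (lab G i) K < size K.
Proof. by rewrite index_mem. Qed.

Lemma ker_adj_sym : symmetric (fun i j => adj G (ker_vertex i) (ker_vertex j)).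
Proof. by move=> i j; apply: adj_sym. Qed.

Lemma ker_adj_irr : irreflexive (fun i j => adj G (ker_vertex i) (ker_vertex j)).
Proof. by move=> i; apply: adj_irr. Qed.

Definition kernel : lcgraph (size K) l c :=
  LCGraph ker_adj_sym ker_adj_irr (fun i => Ordinal (lab_index_lt i))
    (fun i => [set j | ker_vertex j \in col G i]).

Lemma kernel_lab i : ker_vertex (lab kernel i) = lab G i.
Proof. by rewrite /ker_vertex (tnth_nth (lab G i)) /= nth_index. Qed.

Variables (P : seq (seq 'I_n)) (t : nat) (L : seq 'I_n).
Hypothesis partP : nd_partition G P.
Hypothesis eK : K = kern t L P.
Hypothesis eL : L =i [seq lab G i | i <- enum 'I_l].

Let N := [seq (lab G i, lab kernel i) | i <- enum 'I_l].
(** The block alone serves as initial colour: by [block_same_type] it determines the colour classes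
    and, up to equality of the endpoints, adjacency. *)
Let chi1 u := [:: block_index P u].
Let chi2 j := [:: block_index P (ker_vertex j)].

Lemma part_uniq : uniq (flatten P).
Proof. by case: partP => /perm_uniq -> _; rewrite enum_uniq. Qed.

Lemma part_mem u : u \in flatten P.
Proof. by case: partP => /perm_mem -> _; rewrite mem_enum. Qed.

Lemma block_same_type u v : block_index P u = block_index P v -> same_type G u v.
Proof.
move=> e; case: partP => _ st.
have vB : v \in nth [::] P (block_index P v).
  by rewrite block_indexE ?part_uniq ?part_mem.
have uB : u \in nth [::] P (block_index P v).
  by rewrite block_indexE ?part_uniq ?part_mem ?e.
apply: (st (nth [::] P (block_index P v))) => //; apply: mem_nth.
by rewrite ltnNge; apply/negP => /(nth_default [::]) e'; rewrite e' in vB.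
Qed.

Lemma named1 u : (u \in unzip1 N) = (u \in L).
Proof. by rewrite eL /N /unzip1 -map_comp. Qed.

Lemma named2 j : (j \in unzip2 N) = (ker_vertex j \in L).
Proof.
rewrite eL /N /unzip2 -map_comp.
apply/mapP/mapP => [[i iI ->]|[i iI e]]; exists i => //.
  exact: kernel_lab.
by apply: ker_vertex_inj; rewrite /= kernel_lab.
Qed.

(** If F lists the unlabelled vertices of a block, the matching cell of the kernel is [take t F],
    and |F| and min(t, |F|) agree up to t. *)
Lemma kernel_similar : similar t N chi1 chi2.
Proof.
split.
- move=> p q /mapP [i _ ->] /mapP [i' _ ->] /=.
  by rewrite -[RHS](inj_eq ker_vertex_inj) !kernel_lab.
- by move=> p /mapP [i _ ->]; rewrite /chi2 /= kernel_lab.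
(* Only one-element lists occur as colours; for all others both cells are empty. *)
case=> [|b [|? ?]]; rewrite /near; last 1 first.
- by rewrite !eq_card0 // => ?; rewrite !inE eqseq_cons /= ?andbF.
- by rewrite !eq_card0 // => ?; rewrite !inE andbF.
have uP := part_uniq.
set F := [seq x <- nth [::] P b | x \notin L].
have uF : uniq F.
  apply: filter_uniq.
  case: (ltnP b (size P)) => lt; last by rewrite nth_default.
  by apply: (allP (all_uniq_flatten uP)); apply: mem_nth.
have -> : #|cell (unzip1 N) chi1 [:: b]| = size F.
  rewrite -(card_uniqP uF); apply: eq_card => u.
  by rewrite inE named1 /chi1 eqseq_cons andbT mem_filter block_indexE ?part_mem.
have -> : #|cell (unzip2 N) chi2 [:: b]| = minn t (size F).
  rewrite -size_take_min -(card_uniqP (take_uniq t uF)).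
  rewrite -(card_imset _ ker_vertex_inj).
  apply: eq_card => u; apply/imsetP/idP => [[j]|uF'].
    rewrite inE named2 /chi2 eqseq_cons andbT => /andP [jL /eqP jb] ->.
    have : ker_vertex j \in kern t L P by rewrite -eK mem_tnth.
    rewrite mem_kern // (negPf jL) /= => /hasP [B BP jB].
    suff -> : F = [seq x <- B | x \notin L] by [].
    congr filter; have := mem_take jB; rewrite mem_filter jL /= => jB'.
    have iB : nth [::] P (index B P) = B by rewrite nth_index.
    move: jB'; rewrite -{1}iB block_indexE ?part_mem // jb => /eqP ->.
    by rewrite iB.
  have := mem_take uF'; rewrite mem_filter => /andP [uL uB].
  have [|j ej] := @ker_vertexP u.
    rewrite eK mem_kern //; apply/orP; right; apply/hasP.
    exists (nth [::] P b) => //; apply: mem_nth.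
    by rewrite ltnNge; apply/negP => /(nth_default [::]) e'; rewrite e' in uB.
  exists j => //; rewrite inE named2 /chi2 ej uL eqseq_cons andbT /=.
  by rewrite -block_indexE ?part_mem.
by lia.
Qed.

Lemma kernel_models phi : sentence phi -> need phi <= t ->
  models G phi = models kernel phi.
Proof.
move=> sc le_t.
apply: (game (N := N) (chi1 := chi1) (chi2 := chi2) _ kernel_similar sc le_t).
split=> //.
- move=> u u' v v' [eu] [ev] e; apply: same_type_adj; try exact: block_same_type.
  by rewrite e (inj_eq ker_vertex_inj).
- by move=> u u' i [eu]; rewrite inE; case: (block_same_type eu) => ->.
- by move=> i; apply/mapP; exists i; rewrite ?mem_enum.
Qed.

End Kernel.

(** * Sets as numbers *)

Lemma code_exists (b : nat -> bool) m :
  exists2 s, s < 2 ^ m & forall j, j < m -> odd (iter j half s) = b j.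
Proof.
elim: m b => [|m IH] b; first by exists 0.
have [s lt_s sb] := IH (fun j => b j.+1).
exists (b 0 + s.*2); first by rewrite expnS mul2n; case: (b 0); lia.
case=> [|j] lt_j /=; first by rewrite oddD odd_double addbF; case: (b 0).
by rewrite -iterS iterSr half_bit_double sb.
Qed.

Section Decode.
Variables (n l c : nat) (G : lcgraph n l c) (K : seq 'I_n).
Hypothesis lab_in : forall i, lab G i \in K.
Let m := size K.
Let GK := kernel lab_in.
Variable A : nat -> nat -> nat.
Hypothesis A2 : forall i : 'I_l, A 2 i = lab G i.
Hypothesis A34 : forall u v : 'I_n, A 3 (A 4 u + v) = adj G u v.
Hypothesis A56 : forall (i : 'I_c) (v : 'I_n), A 5 (A 6 i + v) = (v \in col G i).
Hypothesis A9 : forall v : 'I_n, v \in K -> A 9 v = (index v K).+1.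
Hypothesis A10 : forall j : 'I_m, A 10 j = ker_vertex j.
Hypothesis A11 : forall s, s < 2 ^ m -> A 11 s = s./2.

Definition code_mem (s j : nat) : bool := last_bit A (iter j (A 11) s).

Lemma code_memE s j : s < 2 ^ m -> code_mem s j = odd (iter j half s).
Proof.
move=> lt_s; have iterE : iter j (A 11) s = iter j half s /\ iter j half s < 2 ^ m.
  by elim: j => //= j [-> lt_j]; rewrite A11 //; split=> //; lia.
case: iterE => e lt_j; rewrite /code_mem /last_bit e A11 //.
by rewrite addnn -{1}[iter j half s]odd_double_half addnK; case: odd.
Qed.

Record decodes (env : nat -> nat) (vs ss : seq nat) (ev : nat -> option 'I_m)
    (es : nat -> {set 'I_m}) : Prop := Decodes {
  dec_var : {in vs, forall x, exists2 j, ev x = Some j & env (x + x) = j};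
  dec_set : {in ss, forall X,
    forall j : 'I_m, (j \in es X) = code_mem (env (X + X + 1)) j}
}.

Lemma decodes_var env vs ss ev es x j : decodes env vs ss ev es ->
  decodes (upd env (x + x) (val j)) (x :: vs) ss (upd ev x (Some j)) es.
Proof.
move=> [hv hs]; split=> [y|X XS i].
  rewrite inE /upd; case: (y =P x) => [->|ne] /=; first by exists j; rewrite ?eqxx.
  by move=> /hv; rewrite (_ : (y + y == x + x) = false) //; lia.
by rewrite /upd (_ : (X + X + 1 == x + x) = false) ?hs //; lia.
Qed.

Lemma decodes_set env vs ss ev es X s (B : {set 'I_m}) : decodes env vs ss ev es ->
  (forall j : 'I_m, (j \in B) = code_mem s j) ->
  decodes (upd env (X + X + 1) s) vs (X :: ss) ev (upd es X B).
Proof.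
move=> [hv hs] hB; split=> [y yv|Y].
  by rewrite /upd (_ : (y + y == X + X + 1) = false); [exact: hv|lia].
rewrite inE /upd; case: (Y =P X) => [->|ne] /=; first by rewrite eqxx.
by move=> /hs; rewrite (_ : (Y + Y + 1 == X + X + 1) = false) //; lia.
Qed.

Lemma decodes_term env vs ss ev es (t : term l) : decodes env vs ss ev es ->
  term_scoped vs t -> exists2 j, term_val GK ev t = Some j & tval A env t = j.
Proof.
move=> [hv hs]; case: t => [x|i] /= sc; first exact: hv.
exists (lab GK i) => //; by rewrite A2 A9 //= subn1.
Qed.

Section Values.
Variables (g : nat -> bool).

Lemma has_vertex (h : 'I_m -> bool) : (forall j : 'I_m, g j = h j) ->
  has g (iota 0 m) = [exists j, h j].
Proof.
move=> gh; apply/hasP/existsP => [[j]|[j hj]].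
  by rewrite mem_iota => /= lt_j gj; exists (Ordinal lt_j); rewrite -gh.
by exists (val j); rewrite ?gh // mem_iota /=.
Qed.

Lemma all_vertex (h : 'I_m -> bool) : (forall j : 'I_m, g j = h j) ->
  all g (iota 0 m) = [forall j, h j].
Proof.
move=> gh; apply/allP/forallP => [hj j|hj j].
  by rewrite -gh hj // mem_iota /=.
by rewrite mem_iota => /= lt_j; rewrite (gh (Ordinal lt_j)).
Qed.

Variable h : {set 'I_m} -> bool.
Hypothesis gh : forall s (B : {set 'I_m}),
  (forall j : 'I_m, (j \in B) = code_mem s j) -> g s = h B.

Lemma code_of (B : {set 'I_m}) :
  exists2 s, s < 2 ^ m & forall j : 'I_m, (j \in B) = code_mem s j.
Proof.
have [s lt_s sB] :=
  code_exists (fun j => if insub j is Some i then i \in B else false) m.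
by exists s => // j; rewrite code_memE // sB // valK.
Qed.

(** Every number denotes a set through [code_mem], and by [code_of] every set is denoted by a number
    below 2^m. *)
Lemma has_set : has g (iota 0 (2 ^ m)) = [exists B, h B].
Proof.
apply/hasP/existsP => [[s _ gs]|[B hB]].
  exists [set j : 'I_m | code_mem s j]; rewrite -(gh (s := s)) // => j.
  by rewrite inE.
have [s lt_s sB] := code_of B; exists s; first by rewrite mem_iota.
by rewrite (gh sB).
Qed.

Lemma all_set : all g (iota 0 (2 ^ m)) = [forall B, h B].
Proof.
apply/allP/forallP => [gs B|hB s _].
  by have [s lt_s sB] := code_of B; rewrite -(gh sB) gs // mem_iota.
by rewrite (gh (B := [set j : 'I_m | code_mem s j])) // => j; rewrite inE.
Qed.

End Values.

Lemma evl_sat (phi : mso l c) env vs ss ev es : decodes env vs ss ev es ->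
  scoped vs ss phi -> evl A m (2 ^ m) env phi = sat GK ev es phi.
Proof.
elim: phi env vs ss ev es => [t u|t u|t i|t X|f IH|o f IHf g IHg|x f IH|x f IH
  |X f IH|X f IH] env vs ss ev es dec /=.
- case/andP=> st su; have [i -> ->] := decodes_term dec st.
  by have [j -> ->] := decodes_term dec su; rewrite !A10 A34; case: adj.
- case/andP=> st su; have [i -> ->] := decodes_term dec st.
  by have [j -> ->] := decodes_term dec su.
- move=> st; have [j -> ->] := decodes_term dec st.
  by rewrite A10 A56 inE; case: (_ \in _).
- case/andP=> st XS; have [j -> ->] := decodes_term dec st.
  by rewrite (dec_set dec).
- by move=> sc; rewrite (IH _ _ _ _ _ dec).
- by case/andP=> sf sg; rewrite (IHf _ _ _ _ _ dec) // (IHg _ _ _ _ _ dec).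
- by move=> sc; apply: has_vertex => j; apply: IH (decodes_var x j dec) sc.
- by move=> sc; apply: all_vertex => j; apply: IH (decodes_var x j dec) sc.
- by move=> sc; apply: has_set => s B sB; apply: IH (decodes_set X dec sB) sc.
- by move=> sc; apply: all_set => s B sB; apply: IH (decodes_set X dec sB) sc.
Qed.

Lemma evl_models (phi : mso l c) env : sentence phi ->
  evl A m (2 ^ m) env phi = models GK phi.
Proof. by move=> sc; apply: evl_sat sc; split. Qed.

End Decode.

(** * The input and the running time *)

Lemma nth_allpairs_mul (S T R : Type) (f : S -> T -> R) s t x0 y0 z0 i j :
  i < size s -> j < size t ->
  nth z0 [seq f x y | x <- s, y <- t] (i * size t + j) =
    f (nth x0 s i) (nth y0 t j).
Proof.
move=> + lt_j; elim: s i => //= x s IH [|i] lt_i.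
  by rewrite nth_cat size_map lt_j (nth_map y0).
rewrite nth_cat size_map mulSn -addnA ltnNge leq_addr /= addKn.
exact: IH.
Qed.

Lemma at_code_nth p ks q : at_code (nth 0 (p ++ ks ++ q)) (size p) ks.
Proof.
elim: ks p => //= k ks IH p; split; first by rewrite nth_cat ltnn subnn.
by have := IH (rcons p k); rewrite size_rcons cat_rcons.
Qed.

Lemma layout_flatten A8 Bs1 Bs2 :
  (forall i, i <= size (Bs1 ++ Bs2) -> A8 i = sumn (take i (shape (Bs1 ++ Bs2)))) ->
  layout (nth 0 (flatten (Bs1 ++ Bs2))) A8 (size Bs1) (sumn (shape Bs1)) Bs2.
Proof.
elim: Bs2 Bs1 => //= B Bs2 IH Bs1 h8.
have h i : i <= 1 ->
    A8 (size Bs1 + i) = sumn (shape Bs1) + sumn (take i (shape (B :: Bs2))).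
  move=> le_i; rewrite h8 ?size_cat ?leq_add2l /=; last by apply: leq_trans le_i _.
  rewrite /shape map_cat take_cat size_map ltnNge leq_addr /= addKn sumn_cat.
  by [].
split.
- by rewrite -[size Bs1]addn0 h // take0 addn0.
- by rewrite -addn1 h //= take0 addn0.
- rewrite flatten_cat -size_flatten; exact: at_code_nth.
have := IH (rcons Bs1 B); rewrite cat_rcons size_rcons => /(_ h8).
by rewrite /shape map_rcons -cats1 sumn_cat /= addn0.
Qed.

(** With [subset_map], this passes from the vertex numbers handled by the program to the ordinals of
    the graph. *)
Lemma kern_map (S T : eqType) (f : S -> T) t (K : seq S) Bs : injective f ->
  kern t (map f K) (map (map f) Bs) = map f (kern t K Bs).
Proof.
move=> inj; elim: Bs K => //= B Bs IH K; rewrite -IH; congr kern.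
rewrite /kern_step map_cat map_take filter_map; congr (_ ++ take _ (map _ _)).
by apply: eq_filter => x /=; rewrite mem_map.
Qed.

Lemma subset_map (S T : eqType) (f : S -> T) (s : seq S) (r : seq T) :
  {subset r <= map f s} -> exists q, r = map f q.
Proof.
elim: r => [|x r IH] sub; first by exists [::].
have /mapP [y _ ->] := sub x (mem_head _ _).
have [|q ->] := IH; first by move=> z zr; apply: sub; rewrite inE zr orbT.
by exists (y :: q).
Qed.

Section Input.
Variables (n l c : nat) (G : lcgraph n l c) (P : seq (seq 'I_n)) (phi : mso l c).
Let A a i := nth 0 (nth [::] (enc_input G P phi) a) i.

Lemma input_lab (i : 'I_l) : A 2 i = lab G i.
Proof. by rewrite /A /= (nth_map i) ?size_enum_ord // nth_ord_enum. Qed.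

Lemma input_adj (u v : 'I_n) : A 3 (A 4 u + v) = adj G u v.
Proof.
rewrite /A /= (nth_map 0) ?size_iota // nth_iota // add0n.
have := @nth_allpairs_mul _ _ _ (fun u v => nat_of_bool (adj G u v))
  (enum 'I_n) (enum 'I_n) u v 0 u v.
by rewrite !size_enum_ord !nth_ord_enum => ->.
Qed.

Lemma input_col (i : 'I_c) (v : 'I_n) : A 5 (A 6 i + v) = (v \in col G i).
Proof.
rewrite /A /= (nth_map 0) ?size_iota // nth_iota // add0n.
have := @nth_allpairs_mul _ _ _ (fun i v => nat_of_bool (v \in col G i))
  (enum 'I_c) (enum 'I_n) i v 0 i v.
by rewrite !size_enum_ord !nth_ord_enum => ->.
Qed.

Lemma input_layout : layout (A 7) (A 8) 0 0 (map (map val) P).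
Proof.
have -> : A 7 = nth 0 (flatten (map (map val) P)) by rewrite -map_flatten.
have -> : A 8 = nth 0 [seq sumn (take i (shape P)) | i <- iota 0 (size P).+1].
  by [].
apply: (@layout_flatten _ [::] (map (map val) P)) => i.
rewrite cat0s size_map => le_i; rewrite (nth_map 0) ?size_iota // nth_iota //.
rewrite add0n; congr (sumn (take i _)); rewrite /shape -map_comp.
by apply: eq_map => B /=; rewrite size_map.
Qed.

Lemma input_code : at_code (A 1) 0 (enc_mso phi).
Proof. by have := @at_code_nth [::] (enc_mso phi) [::]; rewrite cats0. Qed.

End Input.

Definition iter_cost (e : expr) (p : cmd) : nat := (cost e + worst p).+1.

(** A sum, so that one constant bounds an iteration of each of the five loops. *)
Definition unit_cost : nat :=
  iter_cost scan_cond scan_body + iter_cost label_cond label_body +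
  iter_cost block_cond block_body + iter_cost half_cond half_body +
  iter_cost main_cond main_body.

(** Here a, b, q, v, g stand for [2 ^ qS], [w + l], [qS], [qV] and the logarithm of [qV]. Besides W,
    the left side is a sum of 5 + 2 + 5 + 2 = 14 terms, each at most the product E. *)
Lemma exponent_bound W a b q v g : 0 < a -> 0 < b -> 0 < q -> 0 < v -> 0 < g ->
  W + 5 + 2 * (a * b * v) + (q + b + g + 2) * v + (a * b * v).+1 * q
    <= (W + 14) * (a * b * q ^ 2 * v * g).
Proof.
move=> a0 b0 q0 v0 g0; set E := a * b * q ^ 2 * v * g.
have le x y : 0 < y -> E = x * y -> x <= E by move=> y0 ->; apply: leq_pmulr.
have E1 : 1 <= E by rewrite !muln_gt0 ?expn_gt0 a0 b0 q0 v0 g0.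
have h1 : a * b * v <= E.
  by apply: (le _ (q * q * g)); [rewrite ?muln_gt0 ?q0 | rewrite /E; lia].
have h2 : q * v <= E.
  by apply: (le _ (a * b * q * g)); [rewrite ?muln_gt0 ?a0 ?b0 ?q0 | rewrite /E; lia].
have h3 : b * v <= E.
  by apply: (le _ (a * (q * q) * g)); [rewrite ?muln_gt0 ?a0 ?q0 | rewrite /E; lia].
have h4 : g * v <= E.
  by apply: (le _ (a * b * (q * q))); [rewrite ?muln_gt0 ?a0 ?b0 ?q0 | rewrite /E; lia].
have h5 : v <= E by apply: leq_trans h3; apply: leq_pmull.
have h6 : a * b * v * q <= E.
  by apply: (le _ (q * g)); [rewrite ?muln_gt0 ?q0 | rewrite /E; lia].
have h7 : q <= E by apply: leq_trans h2; apply: leq_pmulr.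
have h8 : W <= W * E by apply: leq_pmulr.
by rewrite !mulnDl mulSn; lia.
Qed.

(** Z bounds M and T, so X = 2^Z absorbs everything polynomial in them, while Y accounts for the
    quantifier loops. The factor W moves into the exponent by W <= 2^W. *)
Lemma time_bound W w qS qV l sP ns nv len M :
  sP <= w -> ns <= qS -> nv <= qV -> 0 < w -> 0 < qS -> 1 < qV -> 0 < len ->
  let T := 2 ^ ns * nv in M = l + sP * T ->
  (len + l + sP * (T + M).+1 + 2 ^ M
    + M.+3 * len * (M.+1 ^ nv * (2 ^ M).+1 ^ ns) + 10) * W
  <= 2 ^ ((W + 14) * (2 ^ qS * (w + l) * qS ^ 2 * qV * trunc_log 2 qV)) * len.
Proof.
move=> hw hS hV w0 S0 V1 len0 T eM; set Z := 2 ^ qS * (w + l) * qV.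
have p0 k : 0 < 2 ^ k by rewrite expn_gt0.
have V0 : 0 < qV by apply: ltnW.
have b0 : 0 < w + l by rewrite addn_gt0 w0.
have leT : T <= 2 ^ qS * qV by rewrite leq_mul // leq_pexp2l.
have leZ k : k <= w + l -> k <= Z.
  by move=> lek; rewrite /Z mulnAC; apply: leq_trans lek (leq_pmull _ _);
     rewrite muln_gt0 p0.
have TZ : T <= Z by rewrite /Z mulnAC; apply: leq_trans leT (leq_pmulr _ _).
have MZ : M <= Z.
  rewrite eM /Z mulnAC mulnDr addnC leq_add //.
    by rewrite mulnC leq_mul.
  by apply: leq_pmull; rewrite muln_gt0 p0.
have lZ : l <= Z by apply: leZ; apply: leq_addl.
have sZ : sP <= Z by apply: leZ; apply: leq_trans hw (leq_addr _ _).
pose X := 2 ^ Z; pose Y := Z.+1 ^ qV * X.+1 ^ qS.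
have X0 : 0 < X by apply: p0.
have ZX : Z < X by apply: ltn_expl.
have Y0 : 0 < Y by rewrite muln_gt0 !expn_gt0.
have YM : M.+1 ^ nv * (2 ^ M).+1 ^ ns <= Y.
  apply: leq_mul.
    by apply: (@leq_trans (M.+1 ^ qV)); rewrite ?leq_pexp2l ?leq_exp2r.
  apply: (@leq_trans ((2 ^ M).+1 ^ qS)); first by rewrite leq_pexp2l.
  by rewrite leq_exp2r // ltnS leq_pexp2l.
(* The summands contribute 1 + 1 + 3 + 1 + 4 + 10 = 20 multiples of the product, rounded up to a
   power of two. *)
have sum_le : len + l + sP * (T + M).+1 + 2 ^ M
    + M.+3 * len * (M.+1 ^ nv * (2 ^ M).+1 ^ ns) + 10
    <= 2 ^ 5 * (X * X * Y) * len.
  have XXY0 : 0 < X * X * Y by rewrite (muln_gt0 (X * X)) (muln_gt0 X) X0 Y0.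
  have hX : X <= X * X * Y by rewrite -mulnA leq_pmulr // muln_gt0 X0.
  have hXX : X * X <= X * X * Y by rewrite leq_pmulr.
  have h1 : sP * (T + M).+1 <= 3 * (X * X).
    have -> : 3 * (X * X) = X * (3 * X) by lia.
    by apply: leq_mul; lia.
  have h2 : 2 ^ M <= X by rewrite leq_pexp2l.
  have h3 : M.+3 * len * (M.+1 ^ nv * (2 ^ M).+1 ^ ns) <= 4 * (X * X * Y) * len.
    rewrite mulnAC leq_mul2r; apply/orP; right.
    apply: (@leq_trans (4 * X * Y)); first by apply: leq_mul => //; lia.
    by rewrite -!mulnA leq_mul2l /= leq_pmull.
  have h4 : len <= X * X * Y * len by rewrite leq_pmull.
  have h5 : X * X * Y <= X * X * Y * len by rewrite leq_pmulr.
  move: h3; rewrite -!(mulnA _ (X * X * Y) len).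
  move: (X * X * Y * len) (X * X * Y) h4 h5 hX hXX => U V; lia.
(* The 2 consists of one for Z + 1 <= 2Z and one for the rounding down in [trunc_log]. *)
have Y_le : Y <= 2 ^ ((qS + (w + l) + trunc_log 2 qV + 2) * qV + Z.+1 * qS).
  rewrite expnD; apply: leq_mul; rewrite expnM leq_exp2r //.
    apply: (@leq_trans (2 * Z)); first by rewrite mul2n -addnn; lia.
    rewrite addn2 expnS leq_mul2l /= -addnS expnD /Z expnD.
    apply: leq_mul; last exact: ltnW (trunc_log_ltn _ _).
    by apply: leq_mul => //; apply: ltnW; apply: ltn_expl.
  by rewrite expnS -/X; lia.
have W_le : W <= 2 ^ W by apply/ltnW/ltn_expl.
apply: leq_trans (leq_mul sum_le W_le) _.
rewrite mulnAC leq_mul2r; apply/orP; right.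
apply: leq_trans (_ : 2 ^ (W + 5 + 2 * Z +
  ((qS + (w + l) + trunc_log 2 qV + 2) * qV + Z.+1 * qS)) <= _).
  rewrite 3!expnD mul2n -addnn expnD (mulnC _ (2 ^ W)) -!mulnA !leq_mul2l /=.
  by rewrite Y_le !orbT.
rewrite leq_pexp2l // addnA; apply: exponent_bound => //.
by rewrite trunc_log_gt0.
Qed.

Lemma runs_while_unit e p k s s' :
  reach e p k s s' -> eval s' e = 0 ->
  loopfree p -> iter_cost e p <= unit_cost ->
  runs (While e p) s (k.+1 * unit_cost) s'.
Proof.
move=> r e0 lp le_u; have [t le_t ex] := runs_while lp r e0.
by exists t => //; apply: leq_trans le_t _; rewrite leq_mul2l le_u orbT.
Qed.

Lemma runs_assign x k s :
  runs (Assign x (Const k)) s 2 (Store (upd (reg s) x k) (arr s)).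
Proof. exact: runs_loopfree. Qed.

Lemma program_correct n l c (G : lcgraph n l c) (P : seq (seq 'I_n)) (phi : mso l c) :
  nd_partition G P -> sentence phi ->
  let T := 2 ^ num_svars phi * num_vvars phi in let M := l + size P * T in
  exists s, runs program (init_store (enc_input G P phi))
    ((mso_len phi + l + size P * (T + M).+1 + 2 ^ M
      + M.+3 * mso_len phi * (M.+1 ^ num_vvars phi * (2 ^ M).+1 ^ num_svars phi)
      + 10) * unit_cost) s /\ reg s rV = nat_of_bool (models G phi).
Proof.
move=> part sc T M; set s0 := init_store _.
set A := arr s0.
pose s1 := Store (upd (reg s0) rD 1) A.
have [||||k1 [s2 [le1 r1 p2 D2 T2]]] := @run_scan _ _ phi s1 0 0.
- exact: input_code.
- by [].
- by [].
- by rewrite muln0.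
have {}T2 : reg s2 rT = T by rewrite T2 D2 /= mul1n.
have A2 a : arr s2 a = A a by rewrite (reach_arr _ r1).
have R2 x : x \notin [:: rPos; rT; rD] -> reg s2 x = 0.
  move=> nx; rewrite (reach_reg _ r1).
    by move: nx; rewrite !inE /= /upd => /norP [_ /norP [_ /negPf ->]].
  have sub : {subset wregs scan_body <= [:: rPos; rT; rD]} by apply/allP.
  exact: contra (sub x) nx.
pose s3 := Store (upd (reg s2) rN 1) (arr s2).
pose labs := [seq val (lab G i) | i <- enum 'I_l].
have K3 : ker_store s3 [::].
  split=> //.
  - by rewrite /= /upd /= R2.
  - by move=> i; rewrite /= A2 /A /= !nth_nil.
  - by move=> i; rewrite /= A2 /A /= !nth_nil.
have [|||||||s4 [K0 [r3 e4 K4 eK0 leK0]]] := @run_labels labs l s3 [::] 0.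
- by rewrite size_map size_enum_ord.
- by move=> i; rewrite /= A2.
- by rewrite /= A2 size_map size_enum_ord.
- by rewrite /= /upd /= R2.
- exact: K3.
- by move=> x; rewrite take0.
- by [].
have lab_size : size labs = l by rewrite size_map size_enum_ord.
have A4 a : a \notin warrs label_body -> arr s4 a = A a.
  by move=> na; rewrite (reach_arr na r3) /= A2.
have R4 x : x \notin wregs label_body -> reg s4 x = reg s3 x.
  by move=> nx; rewrite (reach_reg nx r3).
have [L eL] : exists L : seq 'I_n, K0 = map val L.
  apply: (@subset_map _ _ _ [seq lab G i | i <- enum 'I_l]) => x.
  by rewrite eK0 -map_comp.
have memL : L =i [seq lab G i | i <- enum 'I_l].
  move=> v; rewrite -(mem_map val_inj) -eL eK0 /labs.
  by rewrite (map_comp val (fun i => lab G i)) (mem_map val_inj).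
have uP := part_uniq part.
pose K := kern T L P.
have eK : kern T K0 (map (map val) P) = map val K.
  by rewrite eL; apply: (kern_map T L P val_inj).
pose s5 := Store (upd (reg s4) rI 0) (arr s4).
have K5 : ker_store s5 K0.
  by apply: ker_store_eq K4 _ _ => // x; rewrite !inE => /orP [] /eqP ->.
have leKM : size (kern T K0 (map (map val) P)) <= M.
  apply: leq_trans (kern_size_le _ _ _) _; rewrite size_map leq_add2r.
  by rewrite -lab_size.
have [||||||k5 [s6 [le5 r5 e6 K6]]] :=
    @run_blocks T M (map (map val) P) s5 K0 0 0 K5 _ _ _ _ _ _ leKM.
- by rewrite /= !A4 //; apply: input_layout.
- apply: all_uniq_flatten; rewrite -map_flatten map_inj_uniq //; exact: val_inj.
- by [].
- by rewrite /= A4 // size_map.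
- by rewrite /= /upd /= R4 //= /upd /= R2.
- by rewrite /= /upd /= R4 //= /upd /= T2.
have A6 a : a \notin warrs block_body -> arr s6 a = A a.
  by move=> na; rewrite (reach_arr na r5) /= A4.
have R6 x : x \notin wregs block_body -> reg s6 x = reg s5 x.
  by move=> nx; rewrite (reach_reg nx r5).
pose m := size K.
rewrite eK in K6 leKM; rewrite size_map -/m in leKM.
have [uK6 hM6 hN6 hK6 hI6] := K6; rewrite size_map -/m in hM6 hN6.
pose s7 := Store (upd (reg s6) rI 0) (arr s6).
have [||s8 [r7 e8 H8]] := @run_half (2 ^ m) s7 0 _ erefl.
- by [].
- by [].
have A8 a : a \notin warrs half_body -> arr s8 a = arr s6 a.
  by move=> na; rewrite (reach_arr na r7).
have R8 x : x \notin wregs half_body -> reg s8 x = reg s7 x.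
  by move=> nx; rewrite (reach_reg nx r7).
pose s9 := Store (upd (reg s8) rPos 0) (arr s8).
have lab_in i : lab G i \in K.
  rewrite mem_kern // memL; apply/orP; left.
  by apply: map_f; rewrite mem_enum.
have uK : uniq K by move: uK6; rewrite map_inj_uniq //; exact: val_inj.
have idx (v : 'I_n) : v \in K -> arr s9 9 v = (index v K).+1.
  by move=> vK; rewrite /= A8 // hI6 mem_map ?vK ?index_map //; apply: val_inj.
have c9 : cfg (arr s9) m (2 ^ m) s9 0 0 0 (arr s9 aVar).
  split=> //; first split.
  - by rewrite /= /upd /= R8 //= /upd /=.
  - by rewrite /= /upd /= R8 //= /upd /=.
  split.
  - by rewrite /= /upd /= R8 //= /upd /= R6 //= /upd /= R4 //= /upd /= R2.
  - by [].
  by rewrite /= /upd /= R8 //= /upd /= R6 //= /upd /= R4 //= /upd /= R2.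
have lab2 (i : 'I_l) : arr s9 2 i = lab G i.
  by rewrite /= A8 // A6 //; apply: input_lab.
have [|||k9 le9 [s10 [r9 c10 v10 _]]] :=
  @run_mso l c (arr s9) m (2 ^ m) _ phi s9 0 0 _ c9.
- by move=> i; rewrite lab2 idx // subn1 /= ltnW // index_mem.
- by rewrite /= A8 // A6 //; apply: input_code.
- by move=> x; rewrite /= A8 // A6 // /A /= !nth_nil.
exists s10; split; last first.
  rewrite v10; congr nat_of_bool.
  rewrite (@evl_models n l c G K lab_in (arr s9)) //.
  - by rewrite -(kernel_models lab_in uK part erefl memL sc).
  - by move=> u v; rewrite /= !A8 // !A6 //; apply: input_adj.
  - by move=> i v; rewrite /= !A8 // !A6 //; apply: input_col.
  (* [nth] needs a default vertex, and only j witnesses that there is one. *)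
  - move=> j; have x0 : 'I_n := ker_vertex j.
    by rewrite /= A8 // hK6 (nth_map x0) // /ker_vertex (tnth_nth x0).
  - move=> x ltx; apply: H8; rewrite /= /upd /= hN6.
    by rewrite -addnn; apply: leq_trans ltx (leq_addr _ _).
have [_ _ [m10 p10 d10] _] := c10.
have e10 : eval s10 main_cond = 0 by rewrite /= m10 d10.
have e2 : eval s2 scan_cond = 0 by rewrite /= p2 A2 /A /= subnn.
have E := runs_seq (runs_assign rD 1 s0) (runs_seq (runs_while_unit r1 e2 isT isT) (
  runs_seq (runs_assign rN 1 s2) (runs_seq (runs_while_unit r3 e4 isT isT) (
  runs_seq (runs_assign rI 0 s4) (runs_seq (runs_while_unit r5 e6 isT isT) (
  runs_seq (runs_assign rI 0 s6) (runs_seq (runs_while_unit r7 e8 isT isT) (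
  runs_seq (runs_assign rPos 0 s8) (runs_seq (runs_while_unit r9 e10 isT isT) (
  runs_loopfree s10 (isT : loopfree Skip))))))))))).
have [t le_t ex] := E; exists t => //; apply: leq_trans le_t _.
rewrite size_map in le5.
have u11 : 11 <= unit_cost by [].
have i9 : iters m (2 ^ m) phi <=
    M.+3 * mso_len phi * (M.+1 ^ num_vvars phi * (2 ^ M).+1 ^ num_svars phi).
  have mono a b e : a <= b -> a ^ e <= b ^ e.
    by case: e => // e; rewrite leq_exp2r.
  apply: leq_trans (iters_le _ _ _) _; apply: leq_mul; first by rewrite leq_mul.
  by apply: leq_mul; apply: mono; rewrite ltnS // leq_pexp2l.
have pm : 2 ^ m <= 2 ^ M by rewrite leq_pexp2l.
move: (2 ^ m) (2 ^ M) (iters _ _ _) (_ * _ * (_ * _)) pm i9 le9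
  => p p' q q' pm i9 le9.
move: (size P * _) le5 => d le5.
(* The 6 units: one for the exit test of each of the five loops, and one for the five assignments
   and the final [Skip], which take 5 * 2 + 1 = 11 steps. *)
apply: (@leq_trans ((k1 + l + k5 + p + k9 + 6) * unit_cost)); last first.
  by rewrite leq_mul2r; apply/orP; right; lia.
move: unit_cost u11 => u u11; rewrite !mulSn !mulnDl /=; lia.
Qed.

Theorem theorem2 :
  exists (M : cmd) (K : nat),
    forall (n l c : nat) (G : lcgraph n l c) (P : seq (seq 'I_n))
           (phi : mso l c),
      nd_partition G P -> sentence phi ->
      exists (t : nat) (s : store),
        [/\ exec M (init_store (enc_input G P phi)) t s,
            reg s 0 = nat_of_bool (models G phi)
          & forall w qS qV : nat,
              size P <= w -> num_svars phi <= qS -> num_vvars phi <= qV ->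
              0 < w -> 0 < qS -> 1 < qV ->
              t <= 2 ^ (K * (2 ^ qS * (w + l) * qS ^ 2 * qV * trunc_log 2 qV))
                   * mso_len phi].
Proof.
(* [unit_cost] is the cost factor absorbed into the exponent, and 14 comes from [exponent_bound]. *)
exists program, (unit_cost + 14) => n l c G P phi part sc.
have [s [[t le_t ex] es]] := program_correct part sc.
exists t, s; split=> // w qS qV hw hS hV w0 S0 V1; apply: leq_trans le_t _.
by apply: time_bound => //; case: phi {sc ex es hS hV}.
Qed.
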